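(* Let $\ell>0$. The Hellinger–Kantorovich space $(\mathcal M(X),\mathsf{HK}_\ell)$ is identified with the cone over the spherical space $(\mathcal P(X),\mathsf{SHK}_\ell)$ through the map $(\nu,r)\mapsto r^2\nu$; that is, $\mathsf{SHK}_\ell$ is a metric on $\mathcal P(X)$, and the map $\mathcal P(X)\times[0,\infty)\ni(\nu,r)\mapsto r^2\nu\in\mathcal M(X)$ is surjective, injective up to identifying all points of $\mathcal P(X)\times\{0\}$, and satisfies, for all $\nu_0,\nu_1\in\mathcal P(X)$ and $r_0,r_1\ge0$, $$\mathsf{HK}_\ell^2(r_0^2\nu_0,r_1^2\nu_1)=r_0^2+r_1^2-2r_0r_1\cos\big(\min\{\pi,\mathsf{SHK}_\ell(\nu_0,\nu_1)\}\big).$$ Moreover, $(\mathcal P(X),\mathsf{SHK}_\ell)$ has diameter less than or equal to $\pi/2$.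
   Context: $(X,\mathsf d_X)$ is a geodesic, Polish metric space, $\mathcal M(X)$ is the set of all nonnegative finite Borel measures on $X$, and $\mathcal P(X)\subset\mathcal M(X)$ the probability measures. Let $F(r)=r\log r-r+1$ for $r\ge0$ (with $F(0)=1$) and $L_\ell(R)=-2\log(\cos(\ell R))$ if $\ell R<\pi/2$, $L_\ell(R)=+\infty$ otherwise. For $H_{01}\in\mathcal M(X\times X)$ with marginals $\eta_i=(\pi^i)_\sharp H_{01}=\sigma_i\mu_i\ll\mu_i$, set $\mathcal{LET}_\ell(H_{01};\mu_0,\mu_1)=\int_XF(\sigma_0)\,d\mu_0+\int_XF(\sigma_1)\,d\mu_1+\iint L_\ell(\mathsf d_X(x_0,x_1))\,dH_{01}$. The Hellinger–Kantorovich distance is $\mathsf{HK}_\ell^2(\mu_0,\mu_1)=\min\{\mathcal{LET}_\ell(H_{01};\mu_0,\mu_1): H_{01}\in\mathcal M(X\times X),\ (\pi^i)_\sharp H_{01}\ll\mu_i\}$; it is known to be a metric on $\mathcal M(X)$. The spherical Hellinger–Kantorovich distance is $$\mathsf{SHK}_\ell(\nu_0,\nu_1)=\arccos\big(1-\tfrac12\mathsf{HK}_\ell^2(\nu_0,\nu_1)\big),\qquad \nu_0,\nu_1\in\mathcal P(X).$$ The cone over a metric space $(\mathcal X,\mathsf d_{\mathcal X})$ is the quotient of $\mathcal X\times[0,\infty)$ obtained by identifying all points of $\mathcal X\times\{0\}$, with the metric $\mathsf d_{\mathcal C}^2([x_0,r_0],[x_1,r_1])=r_0^2+r_1^2-2r_0r_1\cos(\min\{\pi,\mathsf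 d_{\mathcal X}(x_0,x_1)\})$. *)

(* Defs.v *)
From HB Require Import structures.
From mathcomp Require Import all_boot all_order all_algebra.
From mathcomp Require Import all_classical all_reals all_analysis.

Set Implicit Arguments.
Unset Strict Implicit.
Unset Printing Implicit Defensive.

Import Order.TTheory GRing.Theory Num.Theory.
Import numFieldNormedType.Exports.

Local Open Scope classical_set_scope.
Local Open Scope ring_scope.

(* Metric spaces that are complete for their given metric; the library's
   [completeType] is pointed, so these spaces are nonempty. *)
#[short(type="completeMetricType")]
HB.structure Definition CompleteMetric (R : numDomainType) :=
  {T of Complete T & Metric R T}.

Definition separable (T : topologicalType) : Prop :=
  exists D : set T, countable D /\ dense D.

Definition geodesic_space (R : realType) (X : metricType R) : Prop :=
  forall x y : X, exists gamma : R -> X,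
    [/\ gamma 0 = x, gamma 1 = y &
        forall s t : R, 0 <= s <= 1 -> 0 <= t <= 1 ->
          mdist (gamma s) (gamma t) = `|s - t| * mdist x y].

(* X with its Borel sigma-algebra.  The product [borel X * borel X] carries the
   product sigma-algebra, which is the Borel one on X * X for separable X. *)
Notation borel X := (g_sigma_algebraType (@open X)).

Notation finmeas X R := {finite_measure set (borel X) -> \bar R}.

(* A measure in the library is a function on all subsets whose values outside of
   the sigma-algebra are irrelevant: two measures are identified when they agree
   on measurable sets. *)
Definition eq_meas d (T : measurableType d) (R : realType)
    (mu nu : set T -> \bar R) : Prop :=
  forall A, measurable A -> mu A = nu A.

Section image_measure.
Context d d' (T : measurableType d) (T' : measurableType d') (R : realType).
Variables (H : {finite_measure set T -> \bar R}) (f : {mfun T >-> T'}).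

Definition image_measure : set T' -> \bar R := pushforward H f.

Let image0 : image_measure set0 = 0%E.
Proof. exact: measure0. Qed.

Let image_ge0 A : (0 <= image_measure A)%E.
Proof. exact: measure_ge0. Qed.

Let image_sigma_additive : semi_sigma_additive image_measure.
Proof. exact: measure_semi_sigma_additive. Qed.

HB.instance Definition _ := isMeasure.Build _ _ _ image_measure
  image0 image_ge0 image_sigma_additive.

Let image_fin : fin_num_fun image_measure.
Proof.
move=> A mA; apply: fin_num_measure.
by rewrite -[X in measurable X]setTI; apply: measurable_funP.
Qed.

HB.instance Definition _ := Measure_isFinite.Build _ _ _ image_measure image_fin.

End image_measure.

HB.instance Definition _ d d' (T : measurableType d) (T' : measurableType d') :=
  isMeasurableFun.Build _ _ _ _ (fst : T * T' -> T) measurable_fst.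

HB.instance Definition _ d d' (T : measurableType d) (T' : measurableType d') :=
  isMeasurableFun.Build _ _ _ _ (snd : T * T' -> T') measurable_snd.

Section hellinger_kantorovich.
Variables (R : realType) (X : completeMetricType R).
Implicit Types (l : R) (mu : finmeas X R) (nu : probability (borel X) R).

Definition plan : Type :=
  {finite_measure set (borel X * borel X)%type -> \bar R}.

Definition marginal0 (H : plan) : finmeas X R := image_measure H fst.

Definition marginal1 (H : plan) : finmeas X R := image_measure H snd.

(* F 0 = 1, since [ln 0 = 0]. *)
Definition entropyF (r : R) : R := r * ln r - r + 1.

Definition costL l (r : R) : \bar R :=
  if l * r < pi / 2 then (- 2 * ln (cos (l * r)))%:E else +oo%E.

(* [density eta mu] is the density of eta with respect to mu if eta `<< mu. *)
Definition density (eta mu : finmeas X R) (x : X) : R :=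
  fine (Radon_Nikodym (charge_of_finite_measure eta) mu x).

Definition LET l (H : plan) mu0 mu1 : \bar R :=
  (\int[mu0]_x (entropyF (density (marginal0 H) mu0 x))%:E
   + \int[mu1]_x (entropyF (density (marginal1 H) mu1 x))%:E
   + \int[H]_z costL l (mdist (z.1 : X) z.2))%E.

(* The square of the Hellinger-Kantorovich distance, as an infimum: it is equal
   to the minimum whenever the latter is attained. *)
Definition HK2 l mu0 mu1 : \bar R :=
  ereal_inf [set LET l H mu0 mu1 | H in
    [set H : plan | marginal0 H `<< mu0 /\ marginal1 H `<< mu1]].

Definition SHK l nu0 nu1 : R := acos (1 - fine (HK2 l nu0 nu1) / 2).

End hellinger_kantorovich.

(* [d] is a metric on the quotient of [T] by [eqv]. *)
Definition metric_upto (R : realType) (T : Type) (eqv : T -> T -> Prop)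
    (d : T -> T -> R) : Prop :=
  [/\ forall x y, 0 <= d x y,
      forall x y, d x y = 0 <-> eqv x y,
      forall x y, d x y = d y x &
      forall x y z, d x z <= d x y + d y z].

Definition diameter (R : realType) (T : Type) (d : T -> T -> R) : \bar R :=
  ereal_sup [set (d z.1 z.2)%:E | z in [set: T * T]].

(* Equality of [x0, r0] and [x1, r1] in the cone over [T] modulo [eqv]. *)
Definition cone_eq (R : realType) (T : Type) (eqv : T -> T -> Prop)
    (z0 z1 : T * {nonneg R}) : Prop :=
  (z0.2%:num = 0 /\ z1.2%:num = 0) \/ (eqv z0.1 z1.1 /\ z0.2%:num = z1.2%:num).

Definition cone_dist2 (R : realType) (T : Type) (d : T -> T -> R)
    (z0 z1 : T * {nonneg R}) : R :=
  z0.2%:num ^+ 2 + z1.2%:num ^+ 2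
  - 2 * z0.2%:num * z1.2%:num * cos (Num.min pi (d z0.1 z1.1)).

Definition cone_map (R : realType) (X : completeMetricType R)
    (z : probability (borel X) R * {nonneg R}) : finmeas X R :=
  mscale (z.2%:num ^+ 2)%:nng z.1.

(* Main.v *)
(** Let [A = (mu0 X + mu1 X - HK2 mu0 mu1) / 2].  For a plan with densities
    [1 / t0] and [1 / t1] of its marginals, [ln u <= u - 1] with
    [u = sqrt (t0 t1) cos (l d)] bounds [A] from above by the integral of [u], and a
    log-sum inequality gives the converse after reweighting the plan by [u].
    Hence, up to an error controlled by the mesh, [A] is the maximum of
    [sum_ij X_ij Y_ij cos (l d (x_i, x_j))] over nonnegative matrices [X], [Y] such
    that the squares in row [i] of [X] sum to at most [mu0 B_i] and the squares in
    column [j] of [Y] to at most [mu1 B_j], for a finite partition into small cells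
    [B_i] around [x_i] and a remainder of small mass.  This quantity is symmetric
    and scales by [r0 r1] when the measures scale by [r0 ^ 2] and [r1 ^ 2], which is
    the cone identity.  For probabilities, gluing two such pairs of matrices and
    applying the Cauchy-Schwarz inequality yields
    [A02 >= A01 A12 - sqrt (1 - A01 ^ 2) sqrt (1 - A12 ^ 2)], the triangle
    inequality for the angles [acos A]; neither minimizers nor disintegrations are
    needed.  Finally, partitions into two cells show that [A = 1] forces
    [mu0 C <= mu1 D] whenever [D] contains a neighbourhood of radius [r > 0] of [C],
    hence equality of the two measures. *)

Require Import Defs.
From HB Require Import structures.
From mathcomp Require Import all_boot all_order all_algebra.
From mathcomp Require Import ring lra.
From mathcomp Require Import all_classical all_reals all_analysis.
From mathcomp Require Import measurable_realfun.

Set Implicit Arguments.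
Unset Strict Implicit.
Unset Printing Implicit Defensive.

Import Order.TTheory GRing.Theory Num.Theory.
Import numFieldNormedType.Exports.

Local Open Scope classical_set_scope.
Local Open Scope ring_scope.

(** * Cauchy-Schwarz and discrete gluing *)

(** A quadratic polynomial without negative values has nonpositive discriminant. For [c > 0] the
    bound is read off at the minimum [t = - b / c]; for [c = 0] an affine function with [b != 0]
    would take the value -1. *)
Lemma discriminant_le (R : realType) (a b c : R) : 0 <= c ->
  (forall t, 0 <= a + 2 * t * b + t ^+ 2 * c) -> b ^+ 2 <= a * c.
Proof.
rewrite le_eqVlt => /predU1P[<-|c0] h.
  have [->|b0] := eqVneq b 0; first by rewrite expr0n mulr0.
  have := h (- (a + 1) / (2 * b)).
  have -> : a + 2 * (- (a + 1) / (2 * b)) * b + (- (a + 1) / (2 * b)) ^+ 2 * 0 = -1.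
    by field.
  lra.
have := h (- b / c).
have -> : a + 2 * (- b / c) * b + (- b / c) ^+ 2 * c = (a * c - b ^+ 2) / c.
  by field; rewrite gt_eqF.
by rewrite pmulr_lge0 ?invr_gt0// subr_ge0.
Qed.

Lemma sum_quadratic (R : realType) (I : finType) (f g : I -> R) t :
  \sum_i (f i + t * g i) ^+ 2 =
  \sum_i f i ^+ 2 + 2 * t * \sum_i f i * g i + t ^+ 2 * \sum_i g i ^+ 2.
Proof.
rewrite !mulr_sumr -!big_split/=; apply: eq_bigr => i _; ring.
Qed.

Lemma cauchy_schwarz (R : realType) (I : finType) (f g : I -> R) :
  (\sum_i f i * g i) ^+ 2 <= (\sum_i f i ^+ 2) * \sum_i g i ^+ 2.
Proof.
apply: discriminant_le => [|t]; first by apply: sumr_ge0 => i _; exact: sqr_ge0.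
by rewrite -sum_quadratic; apply: sumr_ge0 => i _; exact: sqr_ge0.
Qed.

Lemma le_sqrtM (R : realType) (a b c : R) : 0 <= a -> b ^+ 2 <= a * c ->
  b <= Num.sqrt a * Num.sqrt c.
Proof.
move=> a0 h; rewrite -sqrtrM//.
by rewrite (le_trans (ler_norm b))// -sqrtr_sqr ler_wsqrtr.
Qed.

Lemma cauchy_schwarz_sqrt (R : realType) (I : finType) (f g : I -> R) :
  \sum_i f i * g i <= Num.sqrt (\sum_i f i ^+ 2) * Num.sqrt (\sum_i g i ^+ 2).
Proof.
by apply: le_sqrtM; [apply: sumr_ge0 => i _; exact: sqr_ge0|exact: cauchy_schwarz].
Qed.

(* Cauchy-Schwarz for the positive semidefinite form [<f, g> - <f, e> <g, e>]. *)
Lemma angle_le (R : realType) (I : finType) (f g e : I -> R) (a b : R) :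
  \sum_i f i ^+ 2 <= 1 -> \sum_i g i ^+ 2 <= 1 -> \sum_i e i ^+ 2 <= 1 ->
  a = \sum_i f i * e i -> b = \sum_i g i * e i ->
  a * b - Num.sqrt (1 - a ^+ 2) * Num.sqrt (1 - b ^+ 2) <= \sum_i f i * g i.
Proof.
move=> f1 g1 e1 aE bE.
have psd h : 0 <= \sum_i h i ^+ 2 - (\sum_i h i * e i) ^+ 2.
  rewrite subr_ge0 (le_trans (cauchy_schwarz _ _))// ler_piMr//.
  by apply: sumr_ge0 => i _; exact: sqr_ge0.
have h t : 0 <= (\sum_i f i ^+ 2 - a ^+ 2) + 2 * t * (\sum_i f i * g i - a * b)
    + t ^+ 2 * (\sum_i g i ^+ 2 - b ^+ 2).
  have := psd (fun i => f i + t * g i); rewrite sum_quadratic.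
  have -> : \sum_i (f i + t * g i) * e i = a + t * b.
    rewrite aE bE mulr_sumr -big_split/=; apply: eq_bigr => i _; ring.
  by congr (0 <= _); ring.
have {}h := discriminant_le (eq_ind_r (fun x => 0 <= _ - x ^+ 2) (psd g) bE) h.
suff: - (\sum_i f i * g i - a * b) <= Num.sqrt (1 - a ^+ 2) * Num.sqrt (1 - b ^+ 2).
  lra.
apply: le_sqrtM.
  by have := psd f; rewrite -aE => /le_trans; apply; rewrite lerD2r.
by rewrite sqrrN (le_trans h)// ler_pM ?aE ?bE ?psd// -?aE -?bE lerD2r.
Qed.

Section glue.
Context (R : realType) (I K J : finType).
Variables (X Y : I -> K -> R) (Z W : K -> J -> R).
Variables (p : I -> R) (m : K -> R) (q : J -> R).
Hypotheses (X0 : forall i k, 0 <= X i k) (Y0 : forall i k, 0 <= Y i k).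
Hypotheses (Z0 : forall k j, 0 <= Z k j) (W0 : forall k j, 0 <= W k j).
Hypothesis m0 : forall k, 0 <= m k.
Hypotheses (Xp : forall i, \sum_k X i k ^+ 2 <= p i)
  (Ym : forall k, \sum_i Y i k ^+ 2 <= m k)
  (Zm : forall k, \sum_j Z k j ^+ 2 <= m k)
  (Wq : forall j, \sum_k W k j ^+ 2 <= q j).
Hypotheses (p1 : \sum_i p i <= 1) (m1 : \sum_k m k <= 1) (q1 : \sum_j q j <= 1).

Let sumsq_ge0 (L : finType) (f : L -> R) : 0 <= \sum_i f i ^+ 2.
Proof. by apply: sumr_ge0 => i _; exact: sqr_ge0. Qed.

(** [V i j ^ 2] is the sum over [k] of [X i k ^ 2] with conditional weight [Z k j ^ 2 / m k], and
    [V' i j ^ 2] that of [W k j ^ 2] with weight [Y i k ^ 2 / m k]: the outer radii are carried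
    along the middle cell. A cell with [m k = 0] contributes 0, by the convention for division. *)
Let V i j := Num.sqrt (\sum_k (X i k * Z k j / Num.sqrt (m k)) ^+ 2).
Let V' i j := Num.sqrt (\sum_k (Y i k * W k j / Num.sqrt (m k)) ^+ 2).

Let sqrt_mK k : Num.sqrt (m k) ^+ 2 = m k. Proof. exact: sqr_sqrtr. Qed.

Let VE i j : V i j ^+ 2 = \sum_k X i k ^+ 2 * (Z k j ^+ 2 / m k).
Proof.
rewrite /V sqr_sqrtr//; apply: eq_bigr => k _.
by rewrite expr_div_n sqrt_mK exprMn mulrA.
Qed.

Let V'E i j : V' i j ^+ 2 = \sum_k W k j ^+ 2 * (Y i k ^+ 2 / m k).
Proof.
rewrite /V' sqr_sqrtr//; apply: eq_bigr => k _.
by rewrite expr_div_n sqrt_mK exprMn mulrAC mulrC mulrA.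
Qed.

Let div_le1 (L : finType) (f : L -> R) k : \sum_i f i ^+ 2 <= m k ->
  \sum_i (f i ^+ 2 / m k) <= 1.
Proof.
move=> fm; rewrite -mulr_suml; have [mk0|mk0] := eqVneq (m k) 0.
  by rewrite mk0 invr0 mulr0.
by rewrite ler_pdivrMr ?mul1r// lt_def mk0 m0.
Qed.

Let V_le i : \sum_j V i j ^+ 2 <= p i.
Proof.
under eq_bigr do rewrite VE; rewrite exchange_big/= (le_trans _ (Xp i))//.
apply: ler_sum => k _; rewrite -mulr_sumr ler_piMr ?sqr_ge0//; exact: div_le1.
Qed.

Let V'_le j : \sum_i V' i j ^+ 2 <= q j.
Proof.
under eq_bigr do rewrite V'E; rewrite exchange_big/= (le_trans _ (Wq j))//.
apply: ler_sum => k _; rewrite -mulr_sumr ler_piMr ?sqr_ge0//; exact: div_le1.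
Qed.

Let VV' i j : \sum_k X i k * Y i k * (Z k j * W k j) / m k <= V i j * V' i j.
Proof.
apply: le_trans (cauchy_schwarz_sqrt _ _); apply: ler_sum => k _.
rewrite -{1}(sqrt_mK k) expr2 invfM; rewrite le_eqVlt; apply/orP; left; apply/eqP; ring.
Qed.

(* Discrete gluing along the middle marginal [m], without normalizing it.  Summing
   over [i] and [j] first, the cosine of a sum splits into
   [(A k * B k - A' k * B' k) / m k], the [k]-th term of a scalar product of two
   vectors of norm at most 1 indexed by [K + K]. *)
Lemma glue (th : I -> K -> R) (ph : K -> J -> R) :
  exists V V' : I -> J -> R,
  [/\ forall i j, 0 <= V i j, forall i j, 0 <= V' i j,
      forall i, \sum_j V i j ^+ 2 <= p i,
      forall j, \sum_i V' i j ^+ 2 <= q j &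
      forall (c : I -> J -> R) (a b : R),
       (forall i j, 0 <= c i j) ->
       (forall i k j, cos (th i k + ph k j) <= c i j) ->
       a = \sum_i \sum_k X i k * Y i k * cos (th i k) ->
       b = \sum_k \sum_j Z k j * W k j * cos (ph k j) ->
       a * b - Num.sqrt (1 - a ^+ 2) * Num.sqrt (1 - b ^+ 2)
         <= \sum_i \sum_j V i j * V' i j * c i j].
Proof.
exists V, V'; split; [by move=> *; exact: sqrtr_ge0|by move=> *; exact: sqrtr_ge0|
  exact: V_le|exact: V'_le|].
move=> c a b c0 ce aE bE.
pose S k := \sum_i X i k * Y i k; pose T k := \sum_j Z k j * W k j.
pose A k := \sum_i X i k * Y i k * cos (th i k).
pose A' k := \sum_i X i k * Y i k * sin (th i k).
pose B k := \sum_j Z k j * W k j * cos (ph k j).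
pose B' k := \sum_j Z k j * W k j * sin (ph k j).
have XY0 i k : 0 <= X i k * Y i k by exact: mulr_ge0.
have ZW0 k j : 0 <= Z k j * W k j by exact: mulr_ge0.
(* A weighted sum of unit vectors of the plane is no longer than the sum of the weights. *)
have rot (L : finType) (w al : L -> R) : (forall i, 0 <= w i) ->
    (\sum_i w i * cos (al i)) ^+ 2 + (\sum_i w i * sin (al i)) ^+ 2
    <= (\sum_i w i) ^+ 2.
  move=> w0.
  have aux f : (\sum_i w i * f i) ^+ 2 <= (\sum_i w i) * \sum_i w i * f i ^+ 2.
    have := cauchy_schwarz (fun i => Num.sqrt (w i)) (fun i => Num.sqrt (w i) * f i).
    congr (_ ^+ 2 <= _ * _); apply: eq_bigr => i _.
    - by rewrite mulrA -expr2 sqr_sqrtr.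
    - by rewrite sqr_sqrtr.
    - by rewrite exprMn sqr_sqrtr.
  rewrite (le_trans (lerD (aux _) (aux _)))// -mulrDr -big_split/= expr2.
  rewrite ler_wpM2l ?sumr_ge0//; apply: ler_sum => i _.
  by rewrite -mulrDr cos2Dsin2 mulr1.
have SX k : S k ^+ 2 <= (\sum_i X i k ^+ 2) * m k.
  rewrite (le_trans (cauchy_schwarz _ _))// ler_wpM2l//.
have TW k : T k ^+ 2 <= (\sum_j W k j ^+ 2) * m k.
  rewrite (le_trans (cauchy_schwarz _ _))// mulrC ler_wpM2l//.
have SX1 : \sum_k S k ^+ 2 / m k <= 1.
  apply: le_trans p1; apply: le_trans (ler_sum _ (fun i _ => Xp i)).
  rewrite exchange_big/=; apply: ler_sum => k _.
  have [mk0|mk0] := eqVneq (m k) 0; first by rewrite mk0 invr0 mulr0.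
  by rewrite ler_pdivrMr// lt_def mk0 m0.
have TW1 : \sum_k T k ^+ 2 / m k <= 1.
  apply: le_trans q1; apply: le_trans (ler_sum _ (fun i _ => Wq i)).
  rewrite exchange_big/=; apply: ler_sum => k _.
  have [mk0|mk0] := eqVneq (m k) 0; first by rewrite mk0 invr0 mulr0.
  by rewrite ler_pdivrMr// lt_def mk0 m0.
have main : a * b - Num.sqrt (1 - a ^+ 2) * Num.sqrt (1 - b ^+ 2) <=
    \sum_k (A k * B k - A' k * B' k) / m k.
  (* [u] plays the role of [e] in [angle_le]: its scalar products with [f] and [g] are [a] and [b].
     The sign of [B'] makes the scalar product of [f] and [g] equal to the sum of
     [(A k * B k - A' k * B' k) / m k]. *)
  pose f (x : K + K) := match x with inl k => A k / Num.sqrt (m k)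
                                   | inr k => A' k / Num.sqrt (m k) end.
  pose g (x : K + K) := match x with inl k => B k / Num.sqrt (m k)
                                   | inr k => - B' k / Num.sqrt (m k) end.
  pose u (x : K + K) := match x with inl k => Num.sqrt (m k) | inr k => 0 end.
  have f1 : \sum_x f x ^+ 2 <= 1.
    rewrite big_sumType/= -big_split/= (le_trans _ SX1)//; apply: ler_sum => k _.
    rewrite !expr_div_n sqrt_mK -mulrDl ler_wpM2r ?invr_ge0//; exact: rot.
  have g1 : \sum_x g x ^+ 2 <= 1.
    rewrite big_sumType/= -big_split/= (le_trans _ TW1)//; apply: ler_sum => k _.
    rewrite !expr_div_n sqrrN sqrt_mK -mulrDl ler_wpM2r ?invr_ge0//; exact: rot.
  have u1 : \sum_x u x ^+ 2 <= 1.
    rewrite big_sumType/= [X in _ + X]big1 ?addr0 ?expr0n//.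
    by under eq_bigr do rewrite sqrt_mK.
  (* Cancelling [Num.sqrt (m k)] at [m k = 0] requires a zero numerator; the bounds by [m k] on the
     squares of [Y] and [Z] supply it. *)
  have divK k s : (m k = 0 -> s = 0) -> s / Num.sqrt (m k) * Num.sqrt (m k) = s.
    move=> s0; have [mk0|mk0] := eqVneq (m k) 0; first by rewrite s0// !mul0r.
    by rewrite divfK// sqrtr_eq0 -ltNge lt_def mk0 m0.
  have Y_eq0 k i : m k = 0 -> Y i k = 0.
    move=> mk0; have := Ym k; rewrite mk0 => h.
    have /eqP := le_anti (introT andP (conj h (sumsq_ge0 _))).
    rewrite psumr_eq0 => [/allP/(_ i)|? _]; last exact: sqr_ge0.
    by rewrite mem_index_enum sqrf_eq0 => /(_ isT)/eqP.
  have Z_eq0 k j : m k = 0 -> Z k j = 0.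
    move=> mk0; have := Zm k; rewrite mk0 => h.
    have /eqP := le_anti (introT andP (conj h (sumsq_ge0 _))).
    rewrite psumr_eq0 => [/allP/(_ j)|? _]; last exact: sqr_ge0.
    by rewrite mem_index_enum sqrf_eq0 => /(_ isT)/eqP.
  have fu : \sum_x f x * u x = a.
    rewrite big_sumType/= [X in _ + X]big1 ?addr0; last by move=> k _; rewrite mulr0.
    rewrite aE exchange_big/=; apply: eq_bigr => k _; rewrite divK// => mk0.
    by apply: big1 => i _; rewrite Y_eq0// mulr0 mul0r.
  have gu : \sum_x g x * u x = b.
    rewrite big_sumType/= [X in _ + X]big1 ?addr0; last by move=> k _; rewrite mulr0.
    rewrite bE; apply: eq_bigr => k _; rewrite divK// => mk0.
    by apply: big1 => j _; rewrite Z_eq0// !mul0r.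
  apply: le_trans (angle_le f1 g1 u1 (esym fu) (esym gu)) _.
  rewrite big_sumType/= -big_split/=; rewrite le_eqVlt; apply/orP; left; apply/eqP/eq_bigr => k _.
  rewrite -[in RHS](sqrt_mK k) expr2 invfM; ring.
apply: le_trans main _.
have step k : (A k * B k - A' k * B' k) / m k <=
    \sum_i \sum_j X i k * Y i k * (Z k j * W k j) / m k * c i j.
  have E1 (f g : R -> R) : (\sum_i X i k * Y i k * f (th i k)) *
     (\sum_j Z k j * W k j * g (ph k j)) =
     \sum_i \sum_j X i k * Y i k * (Z k j * W k j) * (f (th i k) * g (ph k j)).
    rewrite big_distrlr/=; apply: eq_bigr => i _; apply: eq_bigr => j _; ring.
  have E2 : A k * B k - A' k * B' k =
      \sum_i \sum_j X i k * Y i k * (Z k j * W k j) * cos (th i k + ph k j).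
    rewrite /A /B /A' /B' !E1 -sumrB; apply: eq_bigr => i _; rewrite -sumrB.
    by apply: eq_bigr => j _; rewrite cosD mulrBr.
  rewrite E2 mulr_suml; apply: ler_sum => i _; rewrite mulr_suml.
  apply: ler_sum => j _; rewrite mulrAC ler_wpM2l// divr_ge0//.
  exact: mulr_ge0.
apply: le_trans (ler_sum _ (fun k _ => step k)) _.
rewrite exchange_big/=; apply: ler_sum => i _; rewrite exchange_big/=.
apply: ler_sum => j _; rewrite -mulr_suml ler_wpM2r//; exact: VV'.
Qed.
End glue.

(** * The discrete entropy-transport problem *)

Section discrete.
Context (R : realType) (I J : finType).

(* The perspective function [p * F (h / p)] of the entropy. *)
Definition klent (h p : R) : R := h * ln (h / p) - h + p.

Lemma ln_le_subr1 (x : R) : 0 < x -> ln x <= x - 1.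
Proof.
move=> x0; have := @le_ln1Dx R (x - 1).
by rewrite addrCA subrr addr0 -subr_gt0 opprK subrK; exact.
Qed.

(* For a plan [h] with marginals [a i] and [b j], the relevant choice is
   [X i j ^+ 2 = h i j * p i / a i] and [Y i j ^+ 2 = h i j * q j / b j]: these are
   the two radii of a cone plan, weighted by the plan. *)
Definition subcoupling (X Y : I -> J -> R) (p : I -> R) (q : J -> R) :=
  [/\ forall i j, 0 <= X i j, forall i j, 0 <= Y i j,
      forall i, \sum_j X i j ^+ 2 <= p i &
      forall j, \sum_i Y i j ^+ 2 <= q j].

Lemma discrete_sum (h : I -> J -> R) (p : I -> R) (q : J -> R) (c : I -> J -> R) :
  let a i := \sum_j h i j in let b j := \sum_i h i j in
  \sum_i klent (a i) (p i) + \sum_j klent (b j) (q j)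
    + \sum_i \sum_j h i j * (- 2 * ln (c i j)) =
  \sum_i p i + \sum_j q j + \sum_i \sum_j
    (h i j * (ln (a i / p i) + ln (b j / q j) - 2 - 2 * ln (c i j))).
Proof.
move=> a b; rewrite /klent !big_split/= !sumrN.
have e1 : \sum_i a i * ln (a i / p i) = \sum_i \sum_j h i j * ln (a i / p i).
  by apply: eq_bigr => i _; rewrite mulr_suml.
have e2 : \sum_j b j * ln (b j / q j) = \sum_i \sum_j h i j * ln (b j / q j).
  by rewrite exchange_big; apply: eq_bigr => j _; rewrite mulr_suml.
have e3 : \sum_j b j = \sum_i \sum_j h i j by rewrite exchange_big.
have e4 : \sum_i \sum_j
    (h i j * (ln (a i / p i) + ln (b j / q j) - 2 - 2 * ln (c i j))) =
  \sum_i \sum_j h i j * ln (a i / p i) + \sum_i \sum_j h i j * ln (b j / q j)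
   - 2 * (\sum_i \sum_j h i j) + \sum_i \sum_j h i j * (- 2 * ln (c i j)).
  rewrite mulr_sumr -sumrN -!big_split/=; apply: eq_bigr => i _.
  rewrite mulr_sumr -sumrN -!big_split/=; apply: eq_bigr => j _; ring.
rewrite e4 e1 e2 e3 -/(a _).
rewrite (_ : \sum_i a i = \sum_i \sum_j h i j)//; ring.
Qed.

(** Entrywise, this is [ln u <= u - 1] for [u = s * t * c i j] with [s ^ 2 = p i / a i] and
    [t ^ 2 = q j / b j]. The hypotheses on null rows and columns express absolute continuity of the
    marginals, and the one on [c] finiteness of the cost. *)
Lemma discrete_lower (h : I -> J -> R) (p : I -> R) (q : J -> R) (c : I -> J -> R) :
  (forall i j, 0 <= h i j) -> (forall i, 0 <= p i) -> (forall j, 0 <= q j) ->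
  (forall i, p i = 0 -> \sum_j h i j = 0) ->
  (forall j, q j = 0 -> \sum_i h i j = 0) ->
  (forall i j, 0 < h i j -> 0 < c i j) ->
  exists X Y, subcoupling X Y p q /\
    \sum_i p i + \sum_j q j - 2 * (\sum_i \sum_j X i j * Y i j * c i j) <=
    \sum_i klent (\sum_j h i j) (p i) + \sum_j klent (\sum_i h i j) (q j)
      + \sum_i \sum_j h i j * (- 2 * ln (c i j)).
Proof.
move=> h0 p0 q0 ph qh hc.
pose a i := \sum_j h i j; pose b j := \sum_i h i j.
have a0 i : 0 <= a i by exact: sumr_ge0.
have b0 j : 0 <= b j by exact: sumr_ge0.
exists (fun i j => Num.sqrt (h i j * (p i / a i))),
       (fun i j => Num.sqrt (h i j * (q j / b j))).
split.
  split; [by move=> *; exact: sqrtr_ge0|by move=> *; exact: sqrtr_ge0| |].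
  - move=> i; under eq_bigr do rewrite sqr_sqrtr ?mulr_ge0 ?invr_ge0//.
    rewrite -mulr_suml -/(a i); have [->|ai0] := eqVneq (a i) 0.
      by rewrite mul0r.
    by rewrite mulrC divfK.
  - move=> j; under eq_bigr do rewrite sqr_sqrtr ?mulr_ge0 ?invr_ge0//.
    rewrite -mulr_suml -/(b j); have [->|bj0] := eqVneq (b j) 0.
      by rewrite mul0r.
    by rewrite mulrC divfK.
rewrite discrete_sum/= lerD2l -[X in X <= _]mulNr mulr_sumr.
apply: ler_sum => i _; rewrite mulr_sumr; apply: ler_sum => j _.
have [hij0|] := eqVneq (h i j) 0.
  by rewrite hij0 !mul0r sqrtr0 !mul0r mulr0.
move=> hij0; have {}hij0 : 0 < h i j by rewrite lt_def hij0 h0.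
have ai : 0 < a i.
  by rewrite (lt_le_trans hij0)// /a (bigD1 j)//= lerDl sumr_ge0.
have bj : 0 < b j.
  by rewrite (lt_le_trans hij0)// /b (bigD1 i)//= lerDl sumr_ge0.
have pi : 0 < p i.
  rewrite lt_def p0 andbT; apply/eqP => /ph ai0; by move: ai; rewrite /a ai0 ltxx.
have qj : 0 < q j.
  rewrite lt_def q0 andbT; apply/eqP => /qh bj0; by move: bj; rewrite /b bj0 ltxx.
have cij := hc _ _ hij0.
rewrite -/(a i) -/(b j).
set s := Num.sqrt (p i / a i); set t := Num.sqrt (q j / b j).
have s0 : 0 < s by rewrite sqrtr_gt0 divr_gt0.
have t0 : 0 < t by rewrite sqrtr_gt0 divr_gt0.
have -> : Num.sqrt (h i j * (p i / a i)) * Num.sqrt (h i j * (q j / b j)) =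
    h i j * (s * t).
  rewrite (sqrtrM (p i / a i)) ?h0// (sqrtrM (q j / b j)) ?h0// -/s -/t.
  by rewrite mulrACA -expr2 sqr_sqrtr ?h0.
have lns : ln (a i / p i) = - 2 * ln s.
  rewrite -[a i / p i]invrK invf_div lnV ?posrE ?divr_gt0//.
  rewrite -(sqr_sqrtr (ltW (divr_gt0 pi ai))) -/s lnXn// -mulr_natl; ring.
have lnt : ln (b j / q j) = - 2 * ln t.
  rewrite -[b j / q j]invrK invf_div lnV ?posrE ?divr_gt0//.
  rewrite -(sqr_sqrtr (ltW (divr_gt0 qj bj))) -/t lnXn// -mulr_natl; ring.
have := @ln_le_subr1 (s * t * c i j) (mulr_gt0 (mulr_gt0 s0 t0) cij).
rewrite lns lnt !lnM ?posrE ?mulr_gt0// => hu.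
rewrite -mulrA [X in X <= _](_ : _ = h i j * (- 2 * (s * t * c i j))); last by ring.
by rewrite ler_wpM2l//; lra.
Qed.

(** By [ln u <= u - 1], the [j]-th term is at most [a * X j ^ 2 / p - U j], where [a] is the sum of
    [U]; these bounds have sum at most [a - a = 0]. *)
Lemma log_sum_le (L : finType) (U X : L -> R) (p : R) :
  (forall j, 0 <= U j) -> \sum_j X j ^+ 2 <= p ->
  (forall j, 0 < U j -> 0 < X j) ->
  \sum_j U j * (ln ((\sum_j U j) / p) - ln (U j / X j ^+ 2)) <= 0.
Proof.
move=> U0 Xp UX; set a := \sum_j U j.
have a0 : 0 <= a by exact: sumr_ge0.
have p0 : 0 <= p by rewrite (le_trans _ Xp)// sumr_ge0// => j _; exact: sqr_ge0.
have : \sum_j (a * X j ^+ 2 / p - U j) <= 0.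
  rewrite sumrB -/a -mulr_suml -mulr_sumr subr_le0.
  have [->|pn0] := eqVneq p 0; first by rewrite invr0 mulr0.
  have pp : 0 < p by rewrite lt_def pn0.
  by rewrite ler_pdivrMr// ler_wpM2l.
apply: le_trans; apply: ler_sum => j _.
have [->|Uj] := eqVneq (U j) 0.
  by rewrite mul0r subr0 divr_ge0// mulr_ge0// sqr_ge0.
have {}Uj : 0 < U j by rewrite lt_def Uj U0.
have Xj := UX _ Uj.
have aj : 0 < a by rewrite (lt_le_trans Uj)// /a (bigD1 j)//= lerDl sumr_ge0.
have pj : 0 < p.
  rewrite (lt_le_trans _ Xp)// (bigD1 j)//= ltr_wpDr ?exprn_gt0//.
  by apply: sumr_ge0 => k _; exact: sqr_ge0.
have h := @ln_le_subr1 (a / p / (U j / X j ^+ 2)).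
rewrite -ln_div ?posrE ?divr_gt0 ?exprn_gt0//.
apply: le_trans (ler_wpM2l (U0 j) (h _)) _.
  by rewrite !divr_gt0 ?exprn_gt0.
rewrite le_eqVlt; apply/orP; left; apply/eqP; field.
by rewrite !gt_eqF.
Qed.

(** Here [U] is itself the competing plan. The log-sum inequality applies to each row against [X]
    and to each column against [Y]; in the sum the logarithms of [X] and [Y] cancel and
    [2 * ln (c i j)] remains. *)
Lemma discrete_upper (X Y : I -> J -> R) (p : I -> R) (q : J -> R) (c U : I -> J -> R) :
  subcoupling X Y p q -> (forall i j, 0 <= c i j) ->
  (forall i j, U i j = X i j * Y i j * c i j) ->
  \sum_i klent (\sum_j U i j) (p i) + \sum_j klent (\sum_i U i j) (q j)
      + \sum_i \sum_j U i j * (- 2 * ln (c i j)) <=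
  \sum_i p i + \sum_j q j - 2 * (\sum_i \sum_j X i j * Y i j * c i j).
Proof.
move=> [X0 Y0 Xp Yq] c0 UE.
have U0 i j : 0 <= U i j by rewrite UE !mulr_ge0.
have Upos i j : 0 < U i j -> [/\ 0 < X i j, 0 < Y i j & 0 < c i j].
  rewrite !lt_def X0 Y0 c0 /= !andbT UE => /andP[+ _].
  by rewrite !mulf_eq0 !negb_or => /andP[/andP[-> ->] ->].
have -> : \sum_i \sum_j X i j * Y i j * c i j = \sum_i \sum_j U i j.
  by apply: eq_bigr => i _; apply: eq_bigr => j _; rewrite UE.
rewrite discrete_sum/= lerD2l.
set a := fun i => \sum_j U i j; set b := fun j => \sum_i U i j.
have ha i : \sum_j U i j * (ln (a i / p i) - ln (U i j / X i j ^+ 2)) <= 0.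
  by apply: log_sum_le => // j /Upos[].
have hb j : \sum_i U i j * (ln (b j / q j) - ln (U i j / Y i j ^+ 2)) <= 0.
  by apply: (log_sum_le (U := U^~ j)) => // i /Upos[].
have hab : \sum_i \sum_j (U i j * (ln (a i / p i) - ln (U i j / X i j ^+ 2)) +
    U i j * (ln (b j / q j) - ln (U i j / Y i j ^+ 2))) <= 0.
  under eq_bigr do rewrite big_split/=.
  rewrite big_split/= [X in _ + X <= _]exchange_big/=.
  by rewrite -[leRHS]addr0 lerD// sumr_le0.
rewrite -subr_le0 opprK (le_trans _ hab)// mulr_sumr -big_split/=.
apply: ler_sum => i _; rewrite mulr_sumr -big_split/=; apply: ler_sum => j _.
have [->|Uij] := eqVneq (U i j) 0; first by rewrite !mul0r mulr0 addr0.
have {}Uij : 0 < U i j by rewrite lt_def Uij U0.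
have [Xij Yij cij] := Upos _ _ Uij.
have -> : ln (U i j / X i j ^+ 2) = ln (Y i j) + ln (c i j) - ln (X i j).
  rewrite UE ln_div ?posrE ?exprn_gt0 ?mulr_gt0// !lnM ?posrE ?mulr_gt0//; ring.
have -> : ln (U i j / Y i j ^+ 2) = ln (X i j) + ln (c i j) - ln (Y i j).
  rewrite UE ln_div ?posrE ?exprn_gt0 ?mulr_gt0// !lnM ?posrE ?mulr_gt0//; ring.
rewrite le_eqVlt; apply/orP; left; apply/eqP; ring.
Qed.

End discrete.

(** * Angles *)

Section sphere.
Context (R : realType).
Implicit Types a b : R.

(** For [a] and [b] in [[-1, 1]], this is the cosine of [acos a + acos b]. *)
Definition sphere_cosD a b : R :=
  a * b - Num.sqrt (1 - a ^+ 2) * Num.sqrt (1 - b ^+ 2).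

(** Near 1 the map sending [x] to [Num.sqrt (1 - x ^ 2)] is only Hoelder continuous of exponent 1/2,
    so an error [s ^ 2 / 2] in the cosine costs [s] in the sine. *)
Lemma sqrt_one_sub_le (a b s : R) : 0 <= s -> 0 <= b -> b <= a -> a <= 1 ->
  a <= b + s ^+ 2 / 2 ->
  Num.sqrt (1 - b ^+ 2) <= Num.sqrt (1 - a ^+ 2) + s.
Proof.
move=> s0 b0 ba a1 ab.
have r0 := sqrtr_ge0 (1 - a ^+ 2).
rewrite -[leRHS]ger0_norm ?addr_ge0// -sqrtr_sqr ler_wsqrtr// sqrrD.
rewrite sqr_sqrtr; last by rewrite subr_ge0 expr_le1// (le_trans b0).
have : 0 <= Num.sqrt (1 - a ^+ 2) * s *+ 2 by rewrite mulrn_wge0// mulr_ge0.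
have : a ^+ 2 - b ^+ 2 <= s ^+ 2.
  rewrite subr_sqr; have : (a - b) * (a + b) <= (s ^+ 2 / 2) * 2.
    by rewrite ler_pM ?subr_ge0 ?addr_ge0// ?(le_trans b0)//; lra.
  lra.
lra.
Qed.

(** The product of the cosines loses at most [s ^ 2] and that of the sines at most [2 * s + s ^ 2];
    with [s <= 1] the total is at most [4 * s]. *)
Lemma sphere_cosD_le (a b s a' b' : R) : 0 <= s -> s <= 1 ->
  0 <= a <= 1 -> 0 <= b <= 1 -> 0 <= a' <= 1 -> 0 <= b' <= 1 ->
  a <= a' + s ^+ 2 / 2 -> b <= b' + s ^+ 2 / 2 ->
  sphere_cosD a b <= sphere_cosD a' b' + 4 * s.
Proof.
move=> s0 s1 /andP[a0 a1] /andP[b0 b1] /andP[a'0 a'1] /andP[b'0 b'1] aa' bb'.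
have ss : s ^+ 2 <= s by rewrite expr2 ler_piMl.
have aux (x x' : R) : 0 <= x -> x <= 1 -> 0 <= x' -> x' <= 1 -> x <= x' + s ^+ 2 / 2 ->
    Num.sqrt (1 - x' ^+ 2) <= Num.sqrt (1 - x ^+ 2) + s.
  move=> x0 x1 x'0 x'1 xx'; have [h|/ltW h] := leP x' x; first exact: sqrt_one_sub_le.
  rewrite (@le_trans _ _ (Num.sqrt (1 - x ^+ 2)))// ?lerDl// ler_wsqrtr//.
  by rewrite lerD2l lerN2 ler_pXn2r ?nnegrE.
have A := aux _ _ a0 a1 a'0 a'1 aa'; have B := aux _ _ b0 b1 b'0 b'1 bb'.
have sle1 (x : R) : Num.sqrt (1 - x ^+ 2) <= 1.
  by rewrite -[leRHS]sqrtr1 ler_wsqrtr// gerBl sqr_ge0.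
have A0 := sqrtr_ge0 (1 - a ^+ 2); have B0 := sqrtr_ge0 (1 - b ^+ 2).
have A1 := sle1 a; have B1 := sle1 b.
have P : Num.sqrt (1 - a' ^+ 2) * Num.sqrt (1 - b' ^+ 2) <=
    (Num.sqrt (1 - a ^+ 2) + s) * (Num.sqrt (1 - b ^+ 2) + s).
  by rewrite ler_pM ?sqrtr_ge0.
have Q : a * b <= a' * b' + s ^+ 2.
  have [h|h] := leP (s ^+ 2 / 2) a; last first.
    have : a * b <= s ^+ 2 / 2 * 1 by rewrite ler_pM// ltW.
    have := mulr_ge0 a'0 b'0; have := sqr_ge0 s; lra.
  have h1 : (a - s ^+ 2 / 2) * b <= a' * b by rewrite ler_wpM2r//; lra.
  have h2 : a' * b <= a' * (b' + s ^+ 2 / 2) by rewrite ler_wpM2l.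
  have h3 : a' * (s ^+ 2 / 2) <= s ^+ 2 / 2 by rewrite ler_piMl// divr_ge0 ?sqr_ge0.
  have h4 : s ^+ 2 / 2 * b <= s ^+ 2 / 2 by rewrite ler_piMr// divr_ge0 ?sqr_ge0.
  lra.
have h1 : s * Num.sqrt (1 - a ^+ 2) <= s by rewrite ler_piMr.
have h2 : s * Num.sqrt (1 - b ^+ 2) <= s by rewrite ler_piMr.
rewrite /sphere_cosD; rewrite mulrDl !mulrDr in P.
have := ss; rewrite expr2 in Q *; lra.
Qed.

Lemma le_acos a b : -1 <= a -> a <= b -> b <= 1 -> acos b <= acos a.
Proof.
move=> a1 ab b1; rewrite leNgt; apply/negP => h.
have Ha : -1 <= a <= 1 by rewrite a1 (le_trans ab).
have Hb : -1 <= b <= 1 by rewrite b1 (le_trans a1).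
have := @ltr_cos R (acos a) (acos b).
rewrite !in_itv/= !acos_ge0 ?acos_lepi// => /(_ isT isT).
by rewrite h !acosK ?in_itv/= ?Ha ?Hb// ltNge ab.
Qed.

Lemma acos_le_pihalf a : 0 <= a <= 1 -> acos a <= pi / 2.
Proof. by move=> /andP[a0 a1]; rewrite -acos0 le_acos// lerN10. Qed.

(** Both angles are at most [pi / 2], so their sum lies in [[0, pi]], where [acos] inverts the
    cosine. *)
Lemma acos_triangle a b c : 0 <= a <= 1 -> 0 <= b <= 1 -> c <= 1 ->
  sphere_cosD a b <= c -> acos c <= acos a + acos b.
Proof.
move=> a01 b01 c1 abc; have /andP[a0 a1] := a01; have /andP[b0 b1] := b01.
have am : -1 <= a <= 1 by rewrite a1 (le_trans _ a0)// lerN10.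
have bm : -1 <= b <= 1 by rewrite b1 (le_trans _ b0)// lerN10.
have E : cos (acos a + acos b) = sphere_cosD a b.
  by rewrite cosD !sin_acos// !acosK// in_itv.
have sumpi : acos a + acos b <= pi.
  by have := acos_le_pihalf a01; have := acos_le_pihalf b01; lra.
rewrite -[leRHS](@cosK R); last by rewrite in_itv/= sumpi addr_ge0// acos_ge0.
by rewrite E le_acos// -E cos_geN1.
Qed.

End sphere.

(** * Finite partitions *)

Section partition.
Context d (T : measurableType d) (R : realType).
Variables (mu : {finite_measure set T -> \bar R}) (I : finType) (B : I -> set T).
Hypotheses (mB : forall i, measurable (B i)) (tB : trivIset setT B).

Lemma measure_disjoint_sum :
  fine (mu (\bigcup_i B i)) = \sum_i fine (mu (B i)).
Proof.
have -> : \bigcup_i B i = \bigcup_(i in [set` index_enum I]) B i.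
  by apply/seteqP; split=> x [i _ Bix]; exists i => //; rewrite /= mem_index_enum.
rewrite measure_fin_bigcup//; last exact: sub_trivIset tB.
rewrite -fsbig_seq ?index_enum_uniq//.
rewrite -sum_fine// => i _; exact: fin_num_measure.
Qed.

End partition.

Lemma trivIset_setX (T T' : Type) (I J : eqType) (B : I -> set T) (C : J -> set T') :
  trivIset setT B -> trivIset setT C ->
  trivIset setT (fun ij : I * J => B ij.1 `*` C ij.2).
Proof.
move=> tB tC [i j] [i' j'] _ _ [[x y] [[/= Bx Cy] [/= Bx' Cy']]].
congr pair; first by apply: tB => //; exists x.
by apply: tC => //; exists y.
Qed.

Lemma exists_finite_sum d (T : measurableType d) (R : realType) (L : finType)
    (m : L -> {measure set T -> \bar R}) :
  (forall i, m i setT < +oo)%E ->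
  exists nu : {finite_measure set T -> \bar R}, forall A, nu A = (\sum_i m i A)%E.
Proof.
move=> mfin.
(* [msum] adds a sequence of measures, so the family is enumerated and continued by [mzero]. *)
pose mu (k : nat) : {measure set T -> \bar R} :=
  if insub k is Some i then m (@enum_val L predT i) else mzero.
pose nu : {measure set T -> \bar R} := msum mu #|L|.
have nuE A : nu A = (\sum_i m i A)%E.
  rewrite /nu/= /msum (reindex enum_rank)/=; last exact/onW_bij/enum_rank_bij.
  by apply: eq_bigr => i _; rewrite /mu valK enum_rankK.
have nufin : fin_num_fun nu.
  apply: lty_fin_num_fun; rewrite nuE; apply: lte_sum_pinfty => i _; exact: mfin.
pose nuf : {finite_measure set T -> \bar R} :=
  HB.pack (Measure.sort nu) (Measure_isFinite.Build _ _ _ nu nufin).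
by exists nuf.
Qed.

Section step_functions.
Context d (T : measurableType d) (R : realType).
Variables (I : finType) (B : I -> set T).
Hypotheses (mB : forall i, measurable (B i)) (tB : trivIset setT B)
  (BT : \bigcup_i B i = setT).

Lemma ge0_integral_partition (mu : {measure set T -> \bar R}) (A : set T)
    (f : T -> \bar R) : measurable A -> measurable_fun A f ->
  (forall x, A x -> 0 <= f x)%E ->
  (\int[mu]_(x in A) f x = \sum_i \int[mu]_(x in A `&` B i) f x)%E.
Proof.
move=> mA mf f0.
have AE : A = \big[setU/set0]_(i <- index_enum I) (A `&` B i).
  rewrite -bigcup_seq -setI_bigcupr (_ : \bigcup_(i in _) B i = setT) ?setIT//.
  by rewrite -BT; apply/seteqP; split=> x [i _ Bix]; exists i => //; rewrite /= mem_index_enum.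
rewrite {1}AE ge0_integral_bigsetU -?AE ?index_enum_uniq//.
- by move=> i; exact: measurableI.
- apply: (@sub_trivIset _ _ _ setT) => //; exact: trivIset_setIl.
Qed.

Lemma exists_step (r : I -> R) : exists2 g : T -> R, measurable_fun setT g &
  forall i x, B i x -> g x = r i.
Proof.
have /choice[f fP] : forall x, exists i, B i x.
  by move=> x; have [i _ Bix] : (\bigcup_i B i) x by [rewrite BT]; exists i.
have fB i x : B i x -> f x = i.
  by move=> Bix; apply: tB => //; exists x; split => //; exact: fP.
exists (r \o f); last by move=> i x /fB /= ->.
move=> _ Y mY; rewrite setTI.
rewrite (_ : _ @^-1` _ = \bigcup_(i in [set i | Y (r i)]) B i).
  by apply: fin_bigcup_measurable => //; exact: finite_finset.
apply/seteqP; split => [x /= Yx|x [i /= Yi /fB/= ->]//].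
by exists (f x).
Qed.

Lemma integral_step (mu : {measure set T -> \bar R}) (A : set T) (g : T -> R)
    (r : I -> R) : measurable A -> measurable_fun setT g -> (forall i, 0 <= r i) ->
  (forall i x, B i x -> g x = r i) ->
  (\int[mu]_(x in A) (g x)%:E = \sum_i (r i)%:E * mu (A `&` B i))%E.
Proof.
move=> mA mg r0 gr; rewrite ge0_integral_partition//.
- apply: eq_bigr => i _; rewrite -integral_cst; last exact: measurableI.
  by apply: eq_integral => x; rewrite inE => -[_ /gr ->].
- exact/measurable_EFinP/measurable_funTS.
- move=> x _; have [i _ /gr ->] : (\bigcup_i B i) x by rewrite BT.
  by rewrite lee_fin.
Qed.

End step_functions.

(** * Entropy and cost *)

Section entropy.
Context (R : realType).

(** The left-hand side is the tangent at [t] of the convex function [entropyF], that is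
    [entropyF t + ln t * (s - t)]. *)
Lemma entropyF_ge_tangent (s t : R) : 0 <= s -> 0 < t ->
  s * ln t - t + 1 <= entropyF s.
Proof.
rewrite /entropyF le_eqVlt => /predU1P[<-|s0] t0; first by rewrite !mul0r; lra.
have := @ln_le_subr1 R (t / s) (divr_gt0 t0 s0).
rewrite ln_div ?posrE// => h.
have : s * (ln t - ln s) <= s * (t / s - 1) by rewrite ler_wpM2l// ltW.
rewrite (_ : s * (t / s - 1) = t - s); last by field; rewrite gt_eqF.
lra.
Qed.

Lemma entropyF_ge0 (s : R) : 0 <= entropyF s.
Proof.
have [s0|s0] := leP 0 s.
  by have := entropyF_ge_tangent s0 ltr01; rewrite ln1; lra.
(* Since [ln] is 0 on negative numbers, the value is [1 - s]. Negative arguments matter because the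
   sign of [density] is controlled only almost everywhere. *)
by rewrite /entropyF ln0 ?(ltW s0)//; lra.
Qed.

Lemma measurable_entropyF : measurable_fun setT (@entropyF R).
Proof.
rewrite /entropyF; apply: measurable_funD => //; apply: measurable_funB => //.
by apply: measurable_funM => //; exact: measurable_ln.
Qed.

End entropy.

(** * Densities and Jensen's inequality for the entropy *)

Section density.
Context (R : realType) (X : completeMetricType R).
Implicit Types (eta mu : finmeas X R).

Lemma measurable_density eta mu : eta `<< mu ->
  measurable_fun [set: borel X] (density eta mu).
Proof.
move=> etamu; apply: (measurableT_comp (@fine_measurable _ setT measurableT)).
by apply: measurable_int; exact: Radon_Nikodym_integrable.
Qed.

(** Densities are unique almost everywhere, so the entropy may be computed from any convenient
    version [g]. *)
Lemma entropy_integralE eta mu (g : borel X -> R) : eta `<< mu ->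
  measurable_fun setT g -> (forall x, 0 <= g x) ->
  (forall A, measurable A -> eta A = \int[mu]_(x in A) (g x)%:E)%E ->
  (\int[mu]_x (entropyF (density eta mu x))%:E = \int[mu]_x (entropyF (g x))%:E)%E.
Proof.
move=> etamu mg g0 gE.
apply: ge0_ae_eq_integral => //.
- apply/measurable_EFinP; apply: measurableT_comp; first exact: measurable_entropyF.
  exact: measurable_density.
- by apply/measurable_EFinP; apply: measurableT_comp => //; exact: measurable_entropyF.
- by move=> x _; rewrite lee_fin entropyF_ge0.
- by move=> x _; rewrite lee_fin entropyF_ge0.
have aeq : ae_eq mu setT (Radon_Nikodym (charge_of_finite_measure eta) mu) (EFin \o g).
  apply: integral_ae_eq => //.
  - exact: Radon_Nikodym_integrable.
  - exact/measurable_EFinP.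
  - by move=> A _ mA; rewrite -Radon_Nikodym_integral//; exact: gE.
by apply: filterS aeq => x /= xE _; rewrite /density xE.
Qed.

Lemma exists_density eta mu : eta `<< mu -> exists g : borel X -> R,
  [/\ measurable_fun setT g, forall x, 0 <= g x &
   forall A, measurable A -> eta A = (\int[mu]_(x in A) (g x)%:E)%E].
Proof.
move=> etamu; pose f := Radon_Nikodym_SigmaFinite.f eta mu.
have ffin x : f x \is a fin_num by exact: Radon_Nikodym_SigmaFinite.f_fin_num.
exists (fine \o f); split.
- apply: (measurableT_comp (@fine_measurable _ setT measurableT)) => //.
  by apply: measurable_int; exact: Radon_Nikodym_SigmaFinite.f_integrable.
- by move=> x; rewrite fine_ge0//; exact: Radon_Nikodym_SigmaFinite.f_ge0.
- move=> A mA; rewrite (Radon_Nikodym_SigmaFinite.f_integral etamu mA).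
  by apply: eq_integral => x _; rewrite /= fineK.
Qed.

(** Jensen's inequality on one cell: integrating the tangent inequality at [t] over [B] gives the
    lower bound [h * ln t - t * p + p], which is optimal at [t = h / p]. *)
Lemma entropy_cell_ge eta mu (g : borel X -> R) (B : set (borel X)) :
  eta `<< mu -> measurable_fun setT g -> (forall x, 0 <= g x) ->
  (forall A, measurable A -> eta A = \int[mu]_(x in A) (g x)%:E)%E ->
  measurable B ->
  ((klent (fine (eta B)) (fine (mu B)))%:E <= \int[mu]_(x in B) (entropyF (g x))%:E)%E.
Proof.
move=> etamu mg g0 gE mB.
set h := fine (eta B); set p := fine (mu B).
have hE : eta B = h%:E by rewrite fineK// fin_num_measure.
have pE : mu B = p%:E by rewrite fineK// fin_num_measure.
have mF : measurable_fun B (fun x => (entropyF (g x))%:E).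
  apply/measurable_funTS/measurable_EFinP.
  by apply: measurableT_comp => //; exact: measurable_entropyF.
have F0 x : B x -> (0 <= (entropyF (g x))%:E)%E by rewrite lee_fin entropyF_ge0.
have h0 : 0 <= h by exact: fine_ge0.
have p0 : 0 <= p by exact: fine_ge0.
have key t : 0 < t ->
    ((h * ln t - t * p + p)%:E <= \int[mu]_(x in B) (entropyF (g x))%:E)%E.
  move=> t0; have [Fi|] := boolP (\int[mu]_(x in B) (entropyF (g x))%:E < +oo)%E; last first.
    by rewrite -leNgt leye_eq => /eqP ->; rewrite leey.
  have gi : mu.-integrable B (EFin \o g).
    apply/integrableP; split; first exact/measurable_funTS/measurable_EFinP.
    under eq_integral do rewrite /= ger0_norm//.
    by rewrite -gE// hE ltry.
  have ci : mu.-integrable B (cst (1 - t)%:E).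
    exact: finite_measure_integrable_cst.
  have ic : (\int[mu]_(x in B) cst (1 - t)%:E x = (1 - t)%:E * p%:E)%E.
    by rewrite -pE; exact: integral_cst.
  have -> : (h * ln t - t * p + p)%:E =
      (\int[mu]_(x in B) ((ln t)%:E * (EFin \o g) x + cst (1 - t)%:E x))%E.
    rewrite integralD//; last exact: integrableZl.
    by rewrite integralZl// ic -gE// hE -!EFinM -EFinD; congr EFin; ring.
  apply: le_integral => //.
  - by apply: integrableD => //; exact: integrableZl.
  - apply/integrableP; split => //.
    by under eq_integral do rewrite /= ger0_norm ?entropyF_ge0//.
  - move=> x _ /=; rewrite -EFinM -EFinD lee_fin.
    by have := entropyF_ge_tangent (g0 x) t0; lra.
rewrite /klent.
have [p_eq0|pn0] := eqVneq p 0.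
  have h_eq0 : h = 0.
    have : eta B = 0%E.
      have /null_content_dominatesP/(_ _ mB) := etamu; apply.
      by rewrite -[LHS]/(mu B) pE p_eq0.
    by rewrite hE => -[].
  by rewrite p_eq0 h_eq0 mul0r subr0 addr0; exact: integral_ge0.
have pp : 0 < p by rewrite lt_def pn0.
have [h_eq0|hn0] := eqVneq h 0; last first.
  have hp : 0 < h by rewrite lt_def hn0.
  by have := key (h / p) (divr_gt0 hp pp); rewrite divfK.
rewrite h_eq0 mul0r subr0 add0r.
(* For [h = 0] the optimal [t] would be 0, where there is no tangent; [t = e / p] loses only [e]. *)
apply/lee_addgt0Pr => e e0.
have := key (e / p) (divr_gt0 e0 pp).
rewrite h_eq0 mul0r divfK// => /(leeD2r e%:E); apply: le_trans.
by rewrite -EFinD lee_fin; lra.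
Qed.

Lemma entropy_ge (I : finType) eta mu (B : I -> set (borel X)) :
  eta `<< mu -> (forall i, measurable (B i)) -> trivIset setT B ->
  \bigcup_i B i = setT ->
  ((\sum_i klent (fine (eta (B i))) (fine (mu (B i))))%:E
   <= \int[mu]_x (entropyF (density eta mu x))%:E)%E.
Proof.
move=> etamu mB tB BT; have [g [mg g0 gE]] := exists_density etamu.
rewrite (entropy_integralE etamu mg g0 gE).
rewrite (ge0_integral_partition mB tB BT)//.
- rewrite -sumEFin; apply: lee_sum => i _; rewrite setTI; exact: entropy_cell_ge.
- apply/measurable_EFinP.
  by apply: measurableT_comp => //; exact: measurable_entropyF.
- by move=> x _; rewrite lee_fin entropyF_ge0.
Qed.

End density.

(** * The truncated cosine and the transport cost *)

Section tcos.
Context (R : realType).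
Implicit Types x y : R.

(** With the truncation at [pi / 2], the cost at distance [r] is [- 2 * ln (tcos (l * r))], read as
    infinite where [tcos] vanishes, and [tcos] is nonincreasing and 1-Lipschitz on the nonnegative
    half-line. *)
Definition tcos x : R := cos (Num.min x (pi / 2)).

Let pihalf_gt0 : 0 < pi / 2 :> R.
Proof. by rewrite divr_gt0 ?pi_gt0. Qed.

Lemma min_pihalf_itv x : 0 <= x -> 0 <= Num.min x (pi / 2) <= pi / 2.
Proof.
by move=> x0; rewrite le_min x0 ge_min lexx orbT divr_ge0 ?pi_ge0.
Qed.

Lemma tcos_ge0 x : 0 <= x -> 0 <= tcos x.
Proof.
move=> x0; apply: cos_ge0_pihalf; have /andP[h ->] := min_pihalf_itv x0.
by rewrite andbT (le_trans _ h)// oppr_le0 divr_ge0 ?pi_ge0.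
Qed.

Lemma tcos_le1 x : tcos x <= 1. Proof. exact: cos_le1. Qed.

Lemma tcos0 : tcos 0 = 1.
Proof. by rewrite /tcos min_l ?cos0// divr_ge0 ?pi_ge0. Qed.

Lemma tcos_gt0 x : 0 <= x -> (0 < tcos x) = (x < pi / 2).
Proof.
move=> x0; rewrite /tcos; have [xpi|pix] := ltP x (pi / 2).
  by rewrite cos_gt0_pihalf// xpi (lt_le_trans _ x0)// oppr_lt0 pihalf_gt0.
by rewrite cos_pihalf ltxx.
Qed.

Lemma ler_cos x y : 0 <= x -> x <= y -> y <= pi -> cos y <= cos x.
Proof.
move=> x0 xy ypi; rewrite le_eqVlt; have [->|xny] := eqVneq x y; first by rewrite eqxx.
rewrite ltr_cos ?in_itv/= ?x0 ?ypi ?(le_trans x0)// ?(le_trans xy)//.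
by rewrite lt_neqAle xny xy orbT.
Qed.

Lemma tcos_lt1 x : 0 < x -> tcos x < 1.
Proof.
move=> x0; have /andP[h1 h2] := min_pihalf_itv (ltW x0).
rewrite -cos0 /tcos ltr_cos ?in_itv/= ?lexx ?pi_ge0 ?h1 ?lt_min ?x0 ?pihalf_gt0//=.
by rewrite (le_trans h2)// ler_pdivrMr// ler_peMr ?pi_ge0// ler1n.
Qed.

Lemma le_tcos x y : 0 <= x -> x <= y -> tcos y <= tcos x.
Proof.
move=> x0 xy; apply: ler_cos.
- by have /andP[] := min_pihalf_itv x0.
- by rewrite le_min ge_min xy/= ge_min lexx orbT.
- have /andP[_ /le_trans] := min_pihalf_itv (le_trans x0 xy); apply.
  by rewrite ler_pdivrMr// ler_peMr ?pi_ge0// ler1n.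
Qed.

Lemma cos_lipschitz x y : x <= y -> cos x <= cos y + (y - x).
Proof.
move=> xy.
have h1 t : t \in `]x, y[ -> is_derive t 1 (@cos R) (- sin t) by move=> _; exact: is_derive_cos.
have h2 : {within `[x, y], continuous (@cos R)}.
  exact/continuous_subspaceT/continuous_cos.
have [t _ E] := MVT_segment xy h1 h2.
rewrite -lerBlDl -opprB E -mulNr opprK ler_piMl ?subr_ge0//; exact: sin_le1.
Qed.

Lemma tcosD_le x y z : 0 <= x -> 0 <= y -> 0 <= z -> y <= x + z ->
  tcos x <= tcos y + z.
Proof.
move=> x0 y0 z0 yxz; have [yx|/ltW xy] := leP y x.
  by rewrite (le_trans (le_tcos y0 yx))// lerDl.
have mxy : Num.min x (pi / 2) <= Num.min y (pi / 2).
  by rewrite le_min ge_min xy/= ge_min lexx orbT.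
rewrite /tcos (le_trans (cos_lipschitz mxy))// lerD2l.
rewrite lerBlDr; have [xpi|pix] := leP x (pi / 2).
  by rewrite ge_min addrC yxz.
by rewrite ge_min lerDr z0 orbT.
Qed.

Lemma costLE l r : 0 <= l * r ->
  costL (R := R) l r = if 0 < tcos (l * r) then (- 2 * ln (tcos (l * r)))%:E else +oo%E.
Proof.
move=> lr0; rewrite /costL tcos_gt0//; case: ifPn => // lr.
by rewrite /tcos min_l// ltW.
Qed.

Lemma costL_ge0 l r : 0 <= l * r -> (0 <= costL (R:=R) l r)%E.
Proof.
move=> lr0; rewrite costLE//; case: ifPn => // c0.
by rewrite lee_fin mulNr -mulrN mulr_ge0// oppr_ge0 ln_le0// tcos_le1.
Qed.

Lemma measurable_costL l : measurable_fun setT (@costL R l).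
Proof.
rewrite /costL; apply: measurable_fun_ifT => //.
- by apply: measurable_fun_ltr => //; exact: measurable_funM.
- apply/measurable_EFinP; apply: measurable_funM => //.
  apply: measurableT_comp; first exact: measurable_ln.
  apply: measurableT_comp; last exact: measurable_funM.
  by apply: continuous_measurable_fun; exact: continuous_cos.
Qed.

End tcos.

(** * Measurability of the distance *)

Section separable.
Context (R : realType) (X : completeMetricType R).
Hypothesis sepX : separable X.

Lemma separable_seq : exists u : nat -> X, forall x e, 0 < e ->
  exists n, mdist (u n) x < e.
Proof.
have [D [/countable_injP[f finj] dD]] := sepX.
(* Indices that are not the image under [f] of a point of [D] receive the default value [point]. *)
pose u n := if pselect (exists x, D x /\ f x = n) is left h then sval (cid h) else point.
exists u => x e e0; have [] := dD (ball x e)^°.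
- by exists x; exact: nbhsx_ballx.
- exact: open_interior.
move=> y [/interior_subset xy Dy]; exists (f y); rewrite /u; case: pselect; last first.
  by case; exists y.
move=> h; case: cid => z [Dz fz]/=.
have -> : z = y by apply: finj; rewrite ?inE.
by move: xy; rewrite ballEmdist/= metric_sym.
Qed.

Lemma measurable_mdist_ball (x : X) (e : R) :
  measurable ([set y | mdist x y < e] : set (borel X)).
Proof.
rewrite -ballEmdist; apply: sub_sigma_algebra.
have [e0|e0] := leP e 0.
  rewrite (_ : ball x e = set0); first exact: open0.
  by apply/seteqP; split => // y; rewrite ballEmdist/= ltNge (le_trans e0)// mdist_ge0.
rewrite openE => y; rewrite ballEmdist/= => xy; apply/nbhs_ballP.
exists (e - mdist x y); first by rewrite /= subr_gt0.
move=> z; rewrite !ballEmdist/= => yz.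
by rewrite (le_lt_trans (metric_triangle _ y _))// -ltrBrDl.
Qed.

(** Separability enters here: a sublevel set of the distance is a countable union of products of two
    balls with a common centre [u n], hence lies in the product sigma-algebra. *)
Lemma measurable_mdist :
  measurable_fun setT (fun z : borel X * borel X => mdist (z.1 : X) z.2).
Proof.
move=> _; apply: (measurability _ (RGenInftyO.measurableE R)) => //.
move=> _ [_ [a ->] <-]; rewrite setTI.
have [u uP] := separable_seq.
rewrite [X in measurable X](_ : _ = \bigcup_n \bigcup_(q : rat)
  ([set y : borel X | mdist (u n) y < ratr q] `*`
   [set y : borel X | mdist (u n) y < a - ratr q])).
  apply: bigcupT_measurable => n; apply: bigcupT_measurable_rat => q.
  by apply: measurableX; exact: measurable_mdist_ball.
apply/seteqP; split => [[x y]|[x y] [n _ [q _ []]]] /=; rewrite in_itv/=.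
  (* As [a = mdist x y + 3 * e], any rational [q] between [e] and [2 * e] exceeds the distance from
     [u n] to [x] and leaves [a - q] above [e + mdist x y]. *)
  move=> xya; pose e := (a - mdist x y) / 3.
  have e0 : 0 < e by rewrite divr_gt0// subr_gt0.
  have [n nx] := uP x e e0.
  have /rat_in_itvoo[q] : e < e + e by rewrite ltrDl.
  rewrite in_itv/= => /andP[eq qe]; exists n => //; exists q => //=; split.
    exact: lt_trans nx eq.
  rewrite (le_lt_trans (metric_triangle _ x _))//.
  rewrite (@lt_le_trans _ _ (e + mdist x y)) ?ltrD2r//.
  have -> : a = e + e + e + mdist x y by rewrite /e; field.
  lra.
move=> h1 h2; rewrite (le_lt_trans (metric_triangle _ (u n) _))//.
by rewrite metric_sym; lra.
Qed.

Lemma measurable_cost (l : R) :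
  measurable_fun setT (fun z : borel X * borel X => costL l (mdist (z.1 : X) z.2)).
Proof. exact: measurableT_comp (measurable_costL l) measurable_mdist. Qed.

End separable.

(** * Comparison with the discrete problem *)

Section lower.
Context (R : realType) (X : completeMetricType R).
Hypothesis sepX : separable X.
Variables (l : R) (l_gt0 : 0 < l).

(** Replacing a plan by its masses on the product cells does not increase the functional: the
    entropies decrease by Jensen's inequality, and the cost on a cell is at least
    [- 2 * ln (c i j)]. Then [discrete_lower] applies. *)
Lemma LET_lower (I J : finType) (B : I -> set (borel X)) (C : J -> set (borel X))
    (c : I -> J -> R) (mu0 mu1 : finmeas X R) (H : plan X) :
  (forall i, measurable (B i)) -> trivIset setT B -> \bigcup_i B i = setT ->
  (forall j, measurable (C j)) -> trivIset setT C -> \bigcup_j C j = setT ->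
  (forall i j (x y : X), B i x -> C j y -> tcos (l * mdist x y) <= c i j) ->
  marginal0 H `<< mu0 -> marginal1 H `<< mu1 ->
  exists V W, subcoupling V W (fun i => fine (mu0 (B i))) (fun j => fine (mu1 (C j))) /\
   ((fine (mu0 setT) + fine (mu1 setT) - 2 * (\sum_i \sum_j V i j * W i j * c i j))%:E
     <= LET l H mu0 mu1)%E.
Proof.
move=> mB tB BT mC tC CT cP H0 H1.
pose h i j := fine (H (B i `*` C j)).
have mBC i j : measurable (B i `*` C j) by exact: measurableX.
have tBC := trivIset_setX tB tC.
have h0 i j : 0 <= h i j by exact: fine_ge0.
have hrow i : \sum_j h i j = fine (marginal0 H (B i)).
  have -> : marginal0 H (B i) = H (\bigcup_j (B i `*` C j)).
    rewrite /marginal0/= /image_measure /pushforward; congr (H _).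
    apply/seteqP; split => [[x y] /= Bx|[x y] [j _ []]//].
    by have [j _ Cy] : (\bigcup_j C j) y by [rewrite CT]; exists j.
  rewrite measure_disjoint_sum// => j j' _ _ [[x y] [[_ /= Cy] [_ /= Cy']]].
  by apply: tC => //; exists y.
have hcol j : \sum_i h i j = fine (marginal1 H (C j)).
  have -> : marginal1 H (C j) = H (\bigcup_i (B i `*` C j)).
    rewrite /marginal1/= /image_measure /pushforward; congr (H _).
    apply/seteqP; split => [[x y] /= Cy|[x y] [i _ []]//].
    by have [i _ Bx] : (\bigcup_i B i) x by [rewrite BT]; exists i.
  rewrite measure_disjoint_sum// => i i' _ _ [[x y] [[/= Bx _] [/= Bx' _]]].
  by apply: tB => //; exists x.
have cost0 z : (0 <= costL l (mdist (z.1 : X) z.2))%E.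
  by rewrite costL_ge0// mulr_ge0 ?mdist_ge0// ltW.
have mcost := measurable_cost sepX l.
have costE : (\int[H]_z costL l (mdist (z.1 : X) z.2) =
   \sum_(ij : I * J) \int[H]_(z in B ij.1 `*` C ij.2) costL l (mdist (z.1 : X) z.2))%E.
  rewrite (ge0_integral_partition (B := fun ij => B ij.1 `*` C ij.2))//.
  - by apply: eq_bigr => ij _; rewrite setTI.
  - apply/seteqP; split => // -[x y] _.
    have [i _ Bx] : (\bigcup_i B i) x by rewrite BT.
    have [j _ Cy] : (\bigcup_j C j) y by rewrite CT.
    by exists (i, j).
have cell_ge0 ij : (0 <= \int[H]_(z in B ij.1 `*` C ij.2) costL l (mdist (z.1 : X) z.2))%E.
  by apply: integral_ge0 => z _.
have cell i j (r : \bar R) : (0 <= r)%E ->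
   (forall z, (B i `*` C j) z -> (r <= costL l (mdist (z.1 : X) z.2))%E) ->
   (r * H (B i `*` C j) <= \int[H]_(z in B i `*` C j) costL l (mdist (z.1 : X) z.2))%E.
  move=> r0 rle; rewrite -integral_cst//; apply: ge0_le_integral => //.
  exact: measurable_funTS.
have costlow i j z : 0 < c i j -> (B i `*` C j) z ->
    ((- 2 * ln (c i j))%:E <= costL l (mdist (z.1 : X) z.2))%E.
  move=> c0 [Bz Cz]; rewrite costLE; last by rewrite mulr_ge0 ?mdist_ge0// ltW.
  case: ifPn => t0; last by rewrite leey.
  by rewrite lee_fin !mulNr lerN2 ler_pM2l// ler_ln ?posrE//; exact: cP.
(* If a cell of positive mass has [c i j <= 0], then [tcos] vanishes on it, the cost is infinite,
   and zero matrices suffice. *)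
have [hc|] := pselect (forall i j, 0 < h i j -> 0 < c i j); last first.
  move=> /existsNP[i /existsNP[j /not_implyP[hij /negP]]]; rewrite -leNgt => cij.
  have p0 i' : 0 <= fine (mu0 (B i')) by exact: fine_ge0.
  have q0 j' : 0 <= fine (mu1 (C j')) by exact: fine_ge0.
  exists (fun _ _ => 0), (fun _ _ => 0); split.
    by split => // i'; rewrite big1// => j' _; rewrite expr0n.
  have -> : LET l H mu0 mu1 = +oo%E; last by rewrite leey.
  rewrite /LET addeC; suff -> : (\int[H]_z costL l (mdist (z.1 : X) z.2) = +oo)%E.
    rewrite addye// gt_eqF// (@lt_le_trans _ _ 0%E)// adde_ge0//;
      by apply: integral_ge0 => x _; rewrite lee_fin entropyF_ge0.
  apply/eqP; rewrite -leye_eq costE (bigD1 (i, j))//= (le_trans _ (leeDl _ _))//.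
    apply: (le_trans _ (cell i j +oo%E _ _)) => //.
      by rewrite gt0_mulye//; move: hij; rewrite -lte_fin fineK ?fin_num_measure.
    move=> z [Bz Cz]; rewrite costLE; last by rewrite mulr_ge0 ?mdist_ge0// ltW.
    by rewrite ltNge (le_trans (cP _ _ _ _ Bz Cz))//.
  by apply: sume_ge0.
have p0 i : fine (mu0 (B i)) = 0 -> \sum_j h i j = 0.
  move=> /eqP; rewrite fine_eq0 ?fin_num_measure// => /eqP mu0B; rewrite hrow.
  by have /null_content_dominatesP/(_ _ (mB i)) -> := H0.
have q0 j : fine (mu1 (C j)) = 0 -> \sum_i h i j = 0.
  move=> /eqP; rewrite fine_eq0 ?fin_num_measure// => /eqP mu0C; rewrite hcol.
  by have /null_content_dominatesP/(_ _ (mC j)) -> := H1.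
have [V [W [VW le]]] := discrete_lower h0 (fun i => fine_ge0 (measure_ge0 mu0 (B i)))
   (fun j => fine_ge0 (measure_ge0 mu1 (C j))) p0 q0 hc.
exists V, W; split => //.
have -> : fine (mu0 setT) = \sum_i fine (mu0 (B i)).
  by rewrite -measure_disjoint_sum// BT.
have -> : fine (mu1 setT) = \sum_j fine (mu1 (C j)).
  by rewrite -measure_disjoint_sum// CT.
apply: (@le_trans _ _ _%:E); first by rewrite lee_fin; exact: le.
rewrite /LET !EFinD leeD//.
  rewrite leeD//.
  - under eq_bigr do rewrite hrow; exact: entropy_ge.
  - under eq_bigr do rewrite hcol; exact: entropy_ge.
rewrite costE pair_big/= -sumEFin; apply: lee_sum => -[i j] _ /=.
have [->|hij] := eqVneq (h i j) 0; first by rewrite mul0r; exact: (cell_ge0 (i, j)).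
have {}hij : 0 < h i j by rewrite lt_def hij h0.
(* [c i j] may exceed 1, as it is only an upper bound for the cosine; the discrete cost is then
   negative and nonnegativity of the integral is enough. *)
have [ln0|ln0] := leP 0 (- 2 * ln (c i j)); last first.
  by apply: (le_trans _ (cell_ge0 (i, j))); rewrite lee_fin mulr_ge0_le0// ltW.
rewrite mulrC EFinM /h fineK ?fin_num_measure//; apply: cell => //.
by move=> z; apply: costlow; exact: hc.
Qed.

End lower.

(** The density is constant on each cell, so Jensen's inequality becomes an equality. *)
Lemma entropy_step (R : realType) (X : completeMetricType R) (I : finType)
    (B : I -> set (borel X)) (eta mu : finmeas X R) (a : I -> R) :
  (forall i, measurable (B i)) -> trivIset setT B -> \bigcup_i B i = setT ->
  (forall i, 0 <= a i) -> (forall i, fine (mu (B i)) = 0 -> a i = 0) ->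
  (forall A, measurable A ->
    eta A = \sum_i (a i / fine (mu (B i)))%:E * mu (A `&` B i))%E ->
  eta `<< mu /\
  (\int[mu]_x (entropyF (density eta mu x))%:E =
     (\sum_i klent (a i) (fine (mu (B i))))%:E)%E.
Proof.
move=> mB tB BT a0 ap etaE; set r := fun i => a i / fine (mu (B i)).
have r0 i : 0 <= r i by rewrite divr_ge0// fine_ge0.
have etamu : eta `<< mu.
  apply/null_content_dominatesP => A mA muA; rewrite etaE// big1// => i _.
  rewrite (_ : mu (A `&` B i) = 0%E) ?mule0//; apply/eqP; rewrite -measure_le0.
  by rewrite -muA le_measure ?inE//; exact: measurableI.
split => //.
have [g mg gr] := exists_step mB tB BT r.
have g0 x : 0 <= g x by have [i _ /gr ->] : (\bigcup_i B i) x by rewrite BT.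
rewrite (entropy_integralE etamu mg g0); last first.
  by move=> A mA; rewrite (integral_step mB tB BT _ _ _ r0 gr)// etaE.
rewrite (@integral_step _ _ _ _ _ mB tB BT mu setT _ (fun i => entropyF (r i)))//; first last.
- by move=> i x /gr ->.
- by move=> i; exact: entropyF_ge0.
- by apply: measurableT_comp => //; exact: measurable_entropyF.
rewrite -sumEFin; apply: eq_bigr => i _.
rewrite setTI -[X in (_ * X)%E]fineK ?fin_num_measure// -EFinM; congr EFin.
rewrite /entropyF /klent /r; have [p0|p0] := eqVneq (fine (mu (B i))) 0.
  by rewrite p0 (ap _ p0) !mul0r mulr0 subr0 addr0.
by field.
Qed.

Section upper.
Context (R : realType) (X : completeMetricType R).
Hypothesis sepX : separable X.
Variables (l : R) (l_gt0 : 0 < l).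

(** The competitor spreads the mass [V i j * W i j * c i j] over each cell [B i]*[C j]
    proportionally to [mu0 \x mu1]. Its marginals have piecewise constant densities and its cost on
    a cell is at most [- 2 * ln (c i j)], so [discrete_upper] bounds it. *)
Lemma HK2_upper (I J : finType) (B : I -> set (borel X)) (C : J -> set (borel X))
    (c V W : I -> J -> R) (mu0 mu1 : finmeas X R) :
  (forall i, measurable (B i)) -> trivIset setT B -> \bigcup_i B i = setT ->
  (forall j, measurable (C j)) -> trivIset setT C -> \bigcup_j C j = setT ->
  (forall i j, 0 <= c i j) ->
  (forall i j (x y : X), B i x -> C j y -> c i j <= tcos (l * mdist x y)) ->
  subcoupling V W (fun i => fine (mu0 (B i))) (fun j => fine (mu1 (C j))) ->
  (HK2 l mu0 mu1 <= (fine (mu0 setT) + fine (mu1 setT)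
    - 2 * (\sum_i \sum_j V i j * W i j * c i j))%:E)%E.
Proof.
move=> mB tB BT mC tC CT c0 cP VW; have [V0 W0 Vp Wq] := VW.
pose U i j := V i j * W i j * c i j.
have U0 i j : 0 <= U i j by rewrite !mulr_ge0.
pose p i := fine (mu0 (B i)); pose q j := fine (mu1 (C j)).
have p0 i : 0 <= p i by exact: fine_ge0.
have q0 j : 0 <= q j by exact: fine_ge0.
have pE i : mu0 (B i) = (p i)%:E by rewrite fineK// fin_num_measure.
have qE j : mu1 (C j) = (q j)%:E by rewrite fineK// fin_num_measure.
have Up i j : p i = 0 -> U i j = 0.
  move=> pi0; have := Vp i; rewrite -/(p i) pi0 => h.
  have : \sum_j V i j ^+ 2 = 0 by apply/eqP; rewrite eq_le h sumr_ge0// => k _; exact: sqr_ge0.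
  move/eqP; rewrite psumr_eq0 => [/allP/(_ j)|? _]; last exact: sqr_ge0.
  by rewrite mem_index_enum sqrf_eq0 /U => /(_ isT)/eqP ->; rewrite !mul0r.
have Uq i j : q j = 0 -> U i j = 0.
  move=> qj0; have := Wq j; rewrite -/(q j) qj0 => h.
  have : \sum_i W i j ^+ 2 = 0 by apply/eqP; rewrite eq_le h sumr_ge0// => k _; exact: sqr_ge0.
  move/eqP; rewrite psumr_eq0 => [/allP/(_ i)|? _]; last exact: sqr_ge0.
  by rewrite mem_index_enum sqrf_eq0 /U => /(_ isT)/eqP ->; rewrite mulr0 mul0r.
have w0 i j : 0 <= U i j / (p i * q j) by rewrite divr_ge0 ?mulr_ge0.
have wq i j : U i j / (p i * q j) * q j = U i j / p i.
  have [qj0|qj0] := eqVneq (q j) 0; first by rewrite (Uq _ _ qj0) !mul0r.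
  by rewrite invfM mulrA divfK.
have wp i j : U i j / (p i * q j) * p i = U i j / q j.
  have [pi0|pi0] := eqVneq (p i) 0; first by rewrite (Up _ _ pi0) !mul0r.
  by rewrite [p i * q j]mulrC invfM mulrA divfK.
have mBC i j : measurable (B i `*` C j) by exact: measurableX.
(* The factor gives the restricted product measure the total mass [U i j]; if [p i] or [q j] is 0,
   then [U i j = 0] as well. *)
pose m (ij : I * J) : {measure set (borel X * borel X)%type -> \bar R} :=
  mscale (NngNum (w0 ij.1 ij.2)) (mrestr (mu0 \x mu1)%E (mBC ij.1 ij.2)).
have mrect ij (A A' : set (borel X)) : measurable A -> measurable A' ->
    m ij (A `*` A') = ((U ij.1 ij.2 / (p ij.1 * q ij.2))%:E *
      (mu0 (A `&` B ij.1) * mu1 (A' `&` C ij.2)))%E.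
  move=> mA mA'; rewrite /m/= /mscale/= /mrestr/= -setXI; congr (_ * _)%E.
  by rewrite product_measure1E//; exact: measurableI.
have [|H HE] := @exists_finite_sum _ _ R _ m.
  move=> ij; rewrite -setXTT mrect// !setTI pE qE -!EFinM ltry//.
have row A : measurable A ->
    marginal0 H A = (\sum_i ((\sum_j U i j) / p i)%:E * mu0 (A `&` B i))%E.
  move=> mA; rewrite (_ : marginal0 H A = H (A `*` setT)); last first.
    rewrite /marginal0/= /image_measure /pushforward; congr (H _).
    by apply/seteqP; split => [[x y]|[x y] []].
  rewrite HE -(pair_big xpredT xpredT (fun i j => m (i, j) (A `*` setT)))/=.
  apply: eq_bigr => i _; rewrite mulr_suml -sumEFin ge0_sume_distrl; last first.
    by move=> j _; rewrite lee_fin divr_ge0.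
  apply: eq_bigr => j _; rewrite [LHS](mrect (i, j))//= setTI qE muleCA -EFinM wq muleC//.
have col A : measurable A ->
    marginal1 H A = (\sum_j ((\sum_i U i j) / q j)%:E * mu1 (A `&` C j))%E.
  move=> mA; rewrite (_ : marginal1 H A = H (setT `*` A)); last first.
    rewrite /marginal1/= /image_measure /pushforward; congr (H _).
    by apply/seteqP; split => [[x y]|[x y] []].
  rewrite HE -(pair_big xpredT xpredT (fun i j => m (i, j) (setT `*` A)))/= exchange_big/=.
  apply: eq_bigr => j _; rewrite mulr_suml -sumEFin ge0_sume_distrl; last first.
    by move=> i _; rewrite lee_fin divr_ge0.
  apply: eq_bigr => i _; rewrite [LHS](mrect (i, j))//= setTI pE muleA -EFinM wp//.
have HU i j : H (B i `*` C j) = (U i j)%:E.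
  rewrite HE (bigD1 (i, j))//= big1 ?adde0.
    rewrite [LHS](mrect (i, j))//= !setIid pE qE -!EFinM; congr EFin.
    by rewrite mulrCA mulrC wq; have [pi0|pi0] := eqVneq (p i) 0;
      [rewrite (Up _ _ pi0) !mul0r|rewrite divfK].
  move=> [i' j'] /= ne; rewrite [LHS](mrect (i', j'))//=.
  have [ii'|ii'] := eqVneq i i'; last first.
    rewrite (_ : B i `&` B i' = set0) ?measure0 ?mul0e ?mule0//.
    by move/trivIsetP : tB; apply.
  rewrite (_ : C j `&` C j' = set0) ?measure0 ?mule0//.
  move/trivIsetP : tC; apply => //; apply: contra ne => /eqP <-.
  by rewrite ii'.
have a0 i : 0 <= \sum_j U i j by exact: sumr_ge0.
have ap i : p i = 0 -> \sum_j U i j = 0 by move=> pi0; apply: big1 => j _; exact: Up.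
have b0 j : 0 <= \sum_i U i j by exact: sumr_ge0.
have bq j : q j = 0 -> \sum_i U i j = 0 by move=> qj0; apply: big1 => i _; exact: Uq.
have [H0 E0] := entropy_step mB tB BT a0 ap row.
have [H1 E1] := entropy_step mC tC CT b0 bq col.
apply: (@le_trans _ _ (LET l H mu0 mu1)).
  by apply: ereal_inf_lbound; exists H.
have m0E : fine (mu0 setT) = \sum_i p i by rewrite -BT measure_disjoint_sum.
have m1E : fine (mu1 setT) = \sum_j q j by rewrite -CT measure_disjoint_sum.
rewrite m0E m1E.
have := discrete_upper VW c0 (fun i j => erefl (U i j)).
rewrite -lee_fin; apply: le_trans.
rewrite !EFinD /LET E0 E1 leeD2l//.
have mcost := measurable_cost sepX l.
have cost0 z : (0 <= costL l (mdist (z.1 : X) z.2))%E.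
  by rewrite costL_ge0// mulr_ge0 ?mdist_ge0// ltW.
rewrite (ge0_integral_partition (B := fun ij => B ij.1 `*` C ij.2))//; first last.
- apply/seteqP; split => // -[x y] _.
  have [i _ Bx] : (\bigcup_i B i) x by rewrite BT.
  have [j _ Cy] : (\bigcup_j C j) y by rewrite CT.
  by exists (i, j).
- exact: trivIset_setX.
rewrite pair_big/= -sumEFin; apply: lee_sum => -[i j] _ /=; rewrite setTI.
(* Such a cell is null for [H], so an infinite cost on it does no harm. *)
have [Uij|Uij] := eqVneq (U i j) 0.
  rewrite Uij mul0r null_set_integral//; first exact: measurable_funTS.
  by apply: (etrans (HU i j)); rewrite Uij.
have cij : 0 < c i j.
  rewrite lt_def c0 andbT; apply: contra Uij => /eqP.
  by rewrite /U => ->; rewrite mulr0.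
have Bx x y : B i x -> C j y -> c i j <= tcos (l * mdist (x : X) y) by exact: cP.
rewrite mulrC EFinM -HU -integral_cst//; apply: ge0_le_integral => //.
- exact: measurable_funTS.
- move=> [x y] /= [Bix Cjy]; have := Bx x y Bix Cjy => cle.
  rewrite costLE; last by rewrite mulr_ge0 ?mdist_ge0// ltW.
  rewrite (lt_le_trans cij cle) lee_fin !mulNr lerN2 ler_pM2l// ler_ln ?posrE//.
  exact: lt_le_trans cij cle.
Qed.

End upper.

(** * Bounds and symmetries of subcouplings *)

Section subcoupling_bounds.
Context (R : realType) (I J : finType).
Variables (V W : I -> J -> R) (p : I -> R) (q : J -> R).
Hypothesis VW : subcoupling V W p q.

Lemma subcoupling_row i : \sum_j V i j * W i j
  <= Num.sqrt (p i) * Num.sqrt (\sum_j q j).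
Proof.
have [_ _ Vp Wq] := VW; rewrite (le_trans (cauchy_schwarz_sqrt _ _))//.
rewrite ler_pM ?sqrtr_ge0// ler_wsqrtr//; apply: ler_sum => j _.
rewrite (le_trans _ (Wq j))// (bigD1 i)//= lerDl.
by apply: sumr_ge0 => k _; exact: sqr_ge0.
Qed.

Lemma subcoupling_le : \sum_i \sum_j V i j * W i j
  <= Num.sqrt (\sum_i p i) * Num.sqrt (\sum_j q j).
Proof.
have [_ _ Vp Wq] := VW; rewrite pair_bigA/= (le_trans (cauchy_schwarz_sqrt _ _))//.
rewrite -(pair_bigA _ (fun i j => V i j ^+ 2)) -(pair_bigA _ (fun i j => W i j ^+ 2))/=.
rewrite ler_pM ?sqrtr_ge0// ler_wsqrtr//; first exact: ler_sum.
by rewrite exchange_big/=; exact: ler_sum.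
Qed.

Lemma subcoupling_tr :
  subcoupling (fun j i => W i j) (fun j i => V i j) q p.
Proof. by have [? ? ? ?] := VW. Qed.

Lemma subcouplingZ (r s : R) : 0 <= r -> 0 <= s ->
  subcoupling (fun i j => r * V i j) (fun i j => s * W i j)
    (fun i => r ^+ 2 * p i) (fun j => s ^+ 2 * q j).
Proof.
have [V0 W0 Vp Wq] := VW; move=> r0 s0; split.
- by move=> i j; exact: mulr_ge0.
- by move=> i j; exact: mulr_ge0.
- move=> i; under eq_bigr do rewrite exprMn.
  by rewrite -mulr_sumr ler_wpM2l ?sqr_ge0.
- move=> j; under eq_bigr do rewrite exprMn.
  by rewrite -mulr_sumr ler_wpM2l ?sqr_ge0.
Qed.

End subcoupling_bounds.

(** Bounds the total effect of perturbing the kernel by [e] everywhere and by 1 more on the row and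
    on the column of the remainder [i0]. That row and column are controlled by the square roots of
    the masses [p i0] and [q i0], however large the kernel error there. *)
Lemma subcoupling_defect (R : realType) (I : finType) (V W : I -> I -> R)
    (p q : I -> R) (i0 : I) (e : R) : 0 <= e -> subcoupling V W p q ->
  \sum_i \sum_j V i j * W i j * (e + (i == i0)%:R + (j == i0)%:R) <=
  e * (Num.sqrt (\sum_i p i) * Num.sqrt (\sum_j q j))
  + Num.sqrt (p i0) * Num.sqrt (\sum_j q j) + Num.sqrt (\sum_i p i) * Num.sqrt (q i0).
Proof.
move=> e0 VW.
have -> : \sum_i \sum_j V i j * W i j * (e + (i == i0)%:R + (j == i0)%:R) =
   e * (\sum_i \sum_j V i j * W i j) + \sum_j V i0 j * W i0 j + \sum_i W i i0 * V i i0.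
  have -> : \sum_j V i0 j * W i0 j = \sum_i \sum_j V i j * W i j * (i == i0)%:R.
    rewrite [RHS](bigD1 i0)//= [X in _ = _ + X]big1 ?addr0; last first.
      by move=> i /negbTE ->; apply: big1 => j _; rewrite mulr0.
    by apply: eq_bigr => j _; rewrite eqxx mulr1.
  have -> : \sum_i W i i0 * V i i0 = \sum_i \sum_j V i j * W i j * (j == i0)%:R.
    apply: eq_bigr => i _; rewrite [RHS](bigD1 i0)//= big1 ?addr0.
      by rewrite eqxx mulr1 mulrC.
    by move=> j /negbTE ->; rewrite mulr0.
  rewrite mulr_sumr -!big_split/=; apply: eq_bigr => i _.
  rewrite mulr_sumr -!big_split/=; apply: eq_bigr => j _; ring.
rewrite lerD ?lerD ?ler_wpM2l ?subcoupling_le//.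
- exact: subcoupling_row.
- by rewrite mulrC; exact: (subcoupling_row (subcoupling_tr VW)).
Qed.

(** * Affinity *)

Section affinity.
Context (R : realType) (X : completeMetricType R).
Hypothesis sepX : separable X.
Variables (l : R) (l_gt0 : 0 < l).
Implicit Types (mu : finmeas X R).

Definition mass mu : R := fine (mu setT).

(** The counterpart of a scalar product of measures; for probabilities it is the cosine of [SHK]. *)
Definition aff mu0 mu1 : R := (mass mu0 + mass mu1 - fine (HK2 l mu0 mu1)) / 2.

Lemma mass_ge0 mu : 0 <= mass mu. Proof. exact: fine_ge0. Qed.

Lemma LET_ge0 (H : plan X) mu0 mu1 : (0 <= LET l H mu0 mu1)%E.
Proof.
apply: adde_ge0; last first.
  by apply: integral_ge0 => z _; rewrite costL_ge0// mulr_ge0 ?mdist_ge0// ltW.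
by apply: adde_ge0; apply: integral_ge0 => x _; rewrite lee_fin entropyF_ge0.
Qed.

Lemma HK2_ge0 mu0 mu1 : (0 <= HK2 l mu0 mu1)%E.
Proof. by apply: le_ereal_inf_tmp => _ [H _ <-]; exact: LET_ge0. Qed.

(** One cell with zero matrices gives the null plan, which pays only for destroying and creating all
    the mass; hence [HK2] is finite. *)
Lemma HK2_le_mass mu0 mu1 : (HK2 l mu0 mu1 <= (mass mu0 + mass mu1)%:E)%E.
Proof.
have tT : trivIset setT (fun _ : unit => [set: borel X]) by move=> [] [].
have cT : \bigcup_(_ : unit) [set: borel X] = setT.
  by apply/seteqP; split => // x _; exists tt.
have := @HK2_upper R X sepX l l_gt0 unit unit _ _ (fun _ _ => 0) (fun _ _ => 0)
  (fun _ _ => 0) mu0 mu1 (fun _ => measurableT) tT cT (fun _ => measurableT) tT cT.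
rewrite [X in 2 * X]big1 ?mulr0 ?subr0; last first.
  by move=> i _; rewrite big1// => j _; rewrite mulr0.
apply => //.
  by move=> *; apply: tcos_ge0; rewrite mulr_ge0 ?mdist_ge0// ltW.
by split => // i; rewrite big1 ?fine_ge0// => j _; rewrite expr0n.
Qed.

Lemma HK2_fin mu0 mu1 : HK2 l mu0 mu1 \is a fin_num.
Proof.
rewrite ge0_fin_numE ?HK2_ge0//; apply: le_lt_trans (HK2_le_mass _ _) _.
exact: ltry.
Qed.

Lemma HK2E mu0 mu1 : HK2 l mu0 mu1 = (mass mu0 + mass mu1 - 2 * aff mu0 mu1)%:E.
Proof.
by rewrite /aff mulrC divfK// opprB addrC subrK fineK// HK2_fin.
Qed.

Lemma aff_ge0 mu0 mu1 : 0 <= aff mu0 mu1.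
Proof.
rewrite /aff divr_ge0// subr_ge0 -lee_fin fineK ?HK2_fin//; exact: HK2_le_mass.
Qed.

(** An almost optimal plan, taken from the infimum, stands in for a minimizer. *)
Lemma aff_approx mu0 mu1 (e : R) : 0 < e -> exists H : plan X,
  [/\ marginal0 H `<< mu0, marginal1 H `<< mu1 &
   (LET l H mu0 mu1 <= (mass mu0 + mass mu1 - 2 * aff mu0 mu1 + e)%:E)%E].
Proof.
move=> e0; have [_ [H [H0 H1] <-] h] := lb_ereal_inf_adherent e0 (HK2_fin mu0 mu1).
exists H; split => //; apply: le_trans (ltW h) _.
by rewrite -/(HK2 l mu0 mu1) HK2E -EFinD.
Qed.

Lemma aff_lower (I J : finType) (B : I -> set (borel X)) (C : J -> set (borel X))
    (c : I -> J -> R) mu0 mu1 (e : R) : 0 < e ->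
  (forall i, measurable (B i)) -> trivIset setT B -> \bigcup_i B i = setT ->
  (forall j, measurable (C j)) -> trivIset setT C -> \bigcup_j C j = setT ->
  (forall i j (x y : X), B i x -> C j y -> tcos (l * mdist x y) <= c i j) ->
  exists V W, subcoupling V W (fun i => fine (mu0 (B i))) (fun j => fine (mu1 (C j))) /\
   aff mu0 mu1 <= \sum_i \sum_j V i j * W i j * c i j + e.
Proof.
move=> e0 mB tB BT mC tC CT cP.
have [H [H0 H1 Hle]] := aff_approx mu0 mu1 e0.
have [V [W [VW le]]] := LET_lower sepX l_gt0 mB tB BT mC tC CT cP H0 H1.
exists V, W; split => //.
by have := le_trans le Hle; rewrite lee_fin /mass; lra.
Qed.

Lemma aff_upper (I J : finType) (B : I -> set (borel X)) (C : J -> set (borel X))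
    (c V W : I -> J -> R) mu0 mu1 :
  (forall i, measurable (B i)) -> trivIset setT B -> \bigcup_i B i = setT ->
  (forall j, measurable (C j)) -> trivIset setT C -> \bigcup_j C j = setT ->
  (forall i j, 0 <= c i j) ->
  (forall i j (x y : X), B i x -> C j y -> c i j <= tcos (l * mdist x y)) ->
  subcoupling V W (fun i => fine (mu0 (B i))) (fun j => fine (mu1 (C j))) ->
  \sum_i \sum_j V i j * W i j * c i j <= aff mu0 mu1.
Proof.
move=> mB tB BT mC tC CT c0 cP VW.
have := HK2_upper sepX l_gt0 mB tB BT mC tC CT c0 cP VW.
by rewrite HK2E lee_fin /mass; lra.
Qed.

(* [i0] indexes the part of the space that is not covered by the finitely many
   small cells. *)
Definition mesh (I : finType) (i0 : I) (x : I -> X) (B : I -> set (borel X)) (e : R) :=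
  [/\ forall i, measurable (B i), trivIset setT B, \bigcup_i B i = setT &
      forall i (y : X), i != i0 -> B i y -> mdist (x i) y < e].

Section fixed_mesh.
Context (I : finType) (i0 : I) (x : I -> X) (B : I -> set (borel X)) (e : R).
Hypothesis meshB : mesh i0 x B e.
Hypothesis e0 : 0 < e.

Let k i j := tcos (l * mdist (x i) (x j)).
(** Distances between points of two small cells differ from those of the centres by at most [2 * e];
    a cell of the remainder is charged 1, the trivial bound for a difference of values of [tcos]. *)
Let del (i j : I) := l * (2 * e) + (i == i0)%:R + (j == i0)%:R : R.

Definition mesh_err mu0 mu1 : R :=
  l * (2 * e) * (Num.sqrt (mass mu0) * Num.sqrt (mass mu1))
  + Num.sqrt (fine (mu0 (B i0))) * Num.sqrt (mass mu1)
  + Num.sqrt (mass mu0) * Num.sqrt (fine (mu1 (B i0))).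

Let massE mu : mass mu = \sum_i fine (mu (B i)).
Proof.
by have [mB tB BT _] := meshB; rewrite /mass -BT measure_disjoint_sum.
Qed.

Let le0 : 0 <= l * (2 * e). Proof. by rewrite !mulr_ge0// ltW. Qed.

Let ld_ge0 y z : 0 <= l * mdist (y : X) z.
Proof. by rewrite mulr_ge0 ?mdist_ge0// ltW. Qed.

Let dist_le i j (y z : X) : i != i0 -> j != i0 -> B i y -> B j z ->
  `|mdist y z - mdist (x i) (x j)| <= 2 * e.
Proof.
have [_ _ _ Bx] := meshB; move=> ii0 jj0 /(Bx _ _ ii0) iy /(Bx _ _ jj0) jz.
have h1 := metric_triangle y (x i) z; have h2 := metric_triangle (x i) (x j) z.
have h3 := metric_triangle (x i) y (x j); have h4 := metric_triangle y z (x j).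
have h5 := metric_sym y (x i); have h6 := metric_sym z (x j).
rewrite ler_norml; lra.
Qed.

Lemma aff_le_mesh mu0 mu1 (d : R) : 0 < d ->
  exists V W, subcoupling V W (fun i => fine (mu0 (B i))) (fun j => fine (mu1 (B j))) /\
   aff mu0 mu1 <= \sum_i \sum_j V i j * W i j * k i j + mesh_err mu0 mu1 + d.
Proof.
move=> d0; have [mB tB BT Bx] := meshB.
have [|V [W [VW le]]] := @aff_lower I I B B (fun i j => k i j + del i j) mu0 mu1 d
  d0 mB tB BT mB tB BT.
  move=> i j y z Biy Bjz; have kij : 0 <= k i j by exact: tcos_ge0.
  have b1 : 0 <= (i == i0)%:R :> R by exact: ler0n.
  have b2 : 0 <= (j == i0)%:R :> R by exact: ler0n.
  have [ii0|ii0] := eqVneq i i0.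
    have di : (i == i0)%:R = 1 :> R by rewrite ii0 eqxx.
    by rewrite (le_trans (tcos_le1 _))// /del; move: kij b2 le0; rewrite di -/(k i j); lra.
  have [jj0|jj0] := eqVneq j i0.
    have dj : (j == i0)%:R = 1 :> R by rewrite jj0 eqxx.
    by rewrite (le_trans (tcos_le1 _))// /del; move: kij b1 le0; rewrite dj -/(k i j); lra.
  rewrite /del (negbTE ii0) (negbTE jj0) !addr0 tcosD_le//.
  rewrite -mulrDr ler_wpM2l ?(ltW l_gt0)//.
  by have := dist_le ii0 jj0 Biy Bjz; rewrite ler_norml; lra.
exists V, W; split => //; apply: le_trans le _; rewrite lerD2r.
have h := subcoupling_defect i0 le0 VW.
rewrite -!massE -/(mesh_err mu0 mu1) in h.
apply: le_trans (lerD (lexx _) h); rewrite -big_split/=; apply: ler_sum => i _.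
by rewrite -big_split/=; apply: ler_sum => j _; rewrite mulrDr.
Qed.

Lemma aff_ge_mesh mu0 mu1 V W :
  subcoupling V W (fun i => fine (mu0 (B i))) (fun j => fine (mu1 (B j))) ->
  \sum_i \sum_j V i j * W i j * k i j <= aff mu0 mu1 + mesh_err mu0 mu1.
Proof.
move=> VW; have [mB tB BT Bx] := meshB; have [V0 W0 _ _] := VW.
(* The lowered kernel is cut off at 0 because [aff_upper] requires a nonnegative one. *)
have le := @aff_upper I I B B (fun i j => Num.max 0 (k i j - del i j)) V W mu0 mu1
  mB tB BT mB tB BT _ _ VW.
have {}le : \sum_i \sum_j V i j * W i j * Num.max 0 (k i j - del i j) <= aff mu0 mu1.
  apply: le => [i j|i j y z Biy Bjz]; first by rewrite le_max lexx.
  have b1 : 0 <= (i == i0)%:R :> R by exact: ler0n.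
  have b2 : 0 <= (j == i0)%:R :> R by exact: ler0n.
  have k1 : k i j <= 1 by exact: tcos_le1.
  rewrite ge_max tcos_ge0//=; have [ii0|ii0] := eqVneq i i0.
    have di : (i == i0)%:R = 1 :> R by rewrite ii0 eqxx.
    rewrite (@le_trans _ _ 0) ?tcos_ge0//; move: k1 b2 le0.
    by rewrite /del di -/(k i j); lra.
  have [jj0|jj0] := eqVneq j i0.
    have dj : (j == i0)%:R = 1 :> R by rewrite jj0 eqxx.
    rewrite (@le_trans _ _ 0) ?tcos_ge0//; move: k1 b1 le0.
    by rewrite /del dj -/(k i j); lra.
  rewrite /del (negbTE ii0) (negbTE jj0) !addr0 lerBlDr tcosD_le//.
  rewrite -mulrDr ler_wpM2l ?(ltW l_gt0)//.
  by have := dist_le ii0 jj0 Biy Bjz; rewrite ler_norml; lra.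
have := lerD le (subcoupling_defect i0 le0 VW).
rewrite -!massE -/(mesh_err mu0 mu1); apply: le_trans.
rewrite -big_split/=; apply: ler_sum => i _.
rewrite -big_split/=; apply: ler_sum => j _; rewrite -mulrDr ler_wpM2l ?mulr_ge0//.
by rewrite -lerBlDr le_max lexx orbT.
Qed.

End fixed_mesh.
End affinity.

(** * Existence of fine meshes *)

Section mesh_exists.
Context (R : realType) (X : completeMetricType R).
Hypothesis sepX : separable X.
Variables (l : R) (l_gt0 : 0 < l).
Implicit Types (mu : finmeas X R).

Lemma small_remainder (F : nat -> set (borel X)) mu (e : R) : 0 < e ->
  (forall n, measurable (F n)) -> \bigcup_n F n = setT ->
  exists N, forall n, (N <= n)%N ->
    fine (mu (~` \big[setU/set0]_(k < n) F k)) <= e.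
Proof.
move=> e0 mF FT.
pose G n := \big[setU/set0]_(k < n) F k.
have mG n : measurable (G n) by apply: bigsetU_measurable => k _; exact: mF.
have GT : \bigcup_n G n = setT.
  rewrite -FT; apply/seteqP; split => [x [n _]|x [n _ Fnx]].
    by rewrite /G -bigcup_mkord => -[k _ Fkx]; exists k.
  by exists n.+1 => //; rewrite /G -bigcup_mkord; exists n => //=.
have ndG : nondecreasing_seq G.
  by move=> n m nm; apply/subsetPset; rewrite /G; exact: subset_bigsetU.
have cvg : (mu \o G) n @[n --> \oo] --> mu (\bigcup_n G n).
  apply: nondecreasing_cvg_mu => //; rewrite GT; exact: measurableT.
have muT : mu setT = (fine (mu setT))%:E by rewrite fineK// fin_num_measure.
move: cvg; rewrite GT muT => /fine_cvgP[_ /cvgrPdist_le/(_ _ e0)[N _ NP]].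
exists N => n /NP /=; rewrite -/(G n).
have -> : fine (mu setT) = fine (mu (G n)) + fine (mu (~` G n)).
  rewrite -fineD ?fin_num_measure//; last exact: measurableC.
  by rewrite -measureU ?setUv ?setICr//; exact: measurableC.
by rewrite addrC addKr; apply: le_trans; exact: ler_norm.
Qed.

Lemma mesh_exists (K : finType) (M : K -> finmeas X R) (e : R) : 0 < e ->
  exists n (x : 'I_n.+1 -> X) (B : 'I_n.+1 -> set (borel X)),
    mesh ord_max x B e /\ forall a, fine (M a (B ord_max)) <= e.
Proof.
move=> e0; have [u uP] := separable_seq sepX.
pose F n : set (borel X) := [set y : X | mdist (u n) y < e].
have mF n : measurable (F n) by exact: measurable_mdist_ball.
have FT : \bigcup_n F n = setT.
  by apply/seteqP; split => // x _; have [n nx] := uP x e e0; exists n.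
have /choice[N NP] : forall a, exists N, forall n, (N <= n)%N ->
    fine (M a (~` \big[setU/set0]_(k < n) F k)) <= e.
  by move=> a; exact: small_remainder.
pose n := (\max_a N a)%N.
(* The first [n] cells are the balls around the dense sequence made disjoint by [seqDU]; the last
   index carries the remainder, whose centre is arbitrary. *)
pose B (i : 'I_n.+1) := if (i < n)%N then seqDU F i else ~` \big[setU/set0]_(k < n) F k.
exists n, (fun i : 'I_n.+1 => u i), B; split; last first.
  by move=> a; rewrite /B/= ltnn; apply: NP; exact: leq_bigmax.
split.
- move=> i; rewrite /B; case: ifP => _.
    exact: seqDU_measurable.
  by apply: measurableC; exact: bigsetU_measurable.
- move=> i j _ _; rewrite /B; case: ifPn => [in_|]; case: ifPn => [jn|].
  + move=> h; apply: val_inj; exact: (@trivIset_seqDU _ F).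
  + move=> _ [x [[Fx _] /= h]]; exfalso; apply: h.
    by rewrite -bigcup_mkord; exists i.
  + move=> _ [x [/= h [Fx _]]]; exfalso; apply: h.
    by rewrite -bigcup_mkord; exists j.
  + rewrite -!leqNgt => nj ni _; apply: val_inj => /=.
    by apply/eqP; rewrite (@eqn_leq i j) (leq_trans _ nj) ?(leq_trans _ ni)// -ltnS.
- apply/seteqP; split => // x _.
  have [xU|xU] := pselect ((\big[setU/set0]_(k < n) F k) x).
    move: xU; rewrite bigsetU_seqDU -bigcup_mkord => -[k /= kn Fkx].
    by exists (widen_ord (leqnSn n) (Ordinal kn)) => //; rewrite /B/= kn.
  by exists ord_max => //; rewrite /B/= ltnn.
- move=> i y /eqP ne; rewrite /B; case: ifPn => [_ [] //|].
  rewrite -leqNgt => ni; case: ne; apply: val_inj => /=.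
  by apply/eqP; rewrite eqn_leq ni andbT -ltnS.
Qed.

(* Up to [e], the affinity of any two of the measures is the maximum of a
   finite-dimensional problem; since [X] need not be compact, the mesh depends on
   the measures. *)
Lemma aff_mesh (K : finType) (M : K -> finmeas X R) (e : R) : 0 < e ->
  exists n (x : 'I_n -> X) (B : 'I_n -> set (borel X)),
  let p a i := fine (M a (B i)) in
  [/\ forall i, measurable (B i),
      forall a, \sum_i p a i = mass (M a),
      forall a b, exists V W, subcoupling V W (p a) (p b) /\
        aff l (M a) (M b) <=
          \sum_i \sum_j V i j * W i j * tcos (l * mdist (x i) (x j)) + e &
      forall a b V W, subcoupling V W (p a) (p b) ->
        \sum_i \sum_j V i j * W i j * tcos (l * mdist (x i) (x j)) <=
          aff l (M a) (M b) + e].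
Proof.
move=> e0.
pose S := \sum_a Num.sqrt (mass (M a)).
have S0 : 0 <= S by apply: sumr_ge0 => a _; exact: sqrtr_ge0.
have SM a : Num.sqrt (mass (M a)) <= S.
  by rewrite /S (bigD1 a)//= lerDl sumr_ge0// => b _; exact: sqrtr_ge0.
pose C := l * 2 * S ^+ 2 + 2 * S + 1.
have C0 : 0 < C.
  by rewrite /C ltr_pwDr// addr_ge0// !mulr_ge0// ?sqr_ge0// ltW.
(* The mesh parameter will be [s ^ 2], so that the square root of a remainder mass is at most [s]
   and the mesh error at most [s * C <= e / 2]. *)
pose s := Num.min 1 (e / 2 / C).
have s0 : 0 < s by rewrite lt_min ltr01 !divr_gt0.
have s1 : s <= 1 by rewrite ge_min lexx.
have sC : s * C <= e / 2 by rewrite -ler_pdivlMr// ge_min lexx orbT.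
have [n [x [B [mshB Bsmall]]]] := mesh_exists M (exprn_gt0 2 s0).
have err a b : mesh_err l ord_max B (s ^+ 2) (M a) (M b) <= e / 2.
  have small c : Num.sqrt (fine (M c (B ord_max))) <= s.
    by rewrite -[s]ger0_norm ?(ltW s0)// -sqrtr_sqr ler_wsqrtr.
  apply: le_trans sC.
  have h1 : l * (2 * s ^+ 2) * (Num.sqrt (mass (M a)) * Num.sqrt (mass (M b)))
      <= s * (l * 2 * S ^+ 2).
    rewrite (_ : s * _ = l * (2 * s) * (S * S)); last by ring.
    apply: ler_pM.
    - by rewrite !mulr_ge0 ?sqr_ge0// ltW.
    - by rewrite mulr_ge0 ?sqrtr_ge0.
    - rewrite ler_wpM2l ?(ltW l_gt0)// ler_wpM2l// expr2 ler_piMr// ltW//.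
    - by rewrite ler_pM ?sqrtr_ge0.
  have h2 : Num.sqrt (fine (M a (B ord_max))) * Num.sqrt (mass (M b)) <= s * S.
    by rewrite ler_pM ?sqrtr_ge0.
  have h3 : Num.sqrt (mass (M a)) * Num.sqrt (fine (M b (B ord_max))) <= s * S.
    by rewrite mulrC ler_pM ?sqrtr_ge0.
  rewrite /mesh_err (_ : s * C = s * (l * 2 * S ^+ 2) + s * S + s * S + s).
    have := ltW s0; lra.
  by rewrite /C; ring.
exists n.+1, x, B => p; split.
- by have [] := mshB.
- by move=> a; have [mB tB BT _] := mshB; rewrite /mass -BT measure_disjoint_sum.
- move=> a b.
  have [V [W [VW le]]] := aff_le_mesh sepX l_gt0 mshB (exprn_gt0 2 s0)
    (M a) (M b) (divr_gt0 e0 (ltr0n R 2)).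
  exists V, W; split => //; apply: le_trans le _.
  have := err a b; lra.
- move=> a b V W VW.
  have := aff_ge_mesh sepX l_gt0 mshB (exprn_gt0 2 s0) VW.
  have := err a b; lra.
Qed.

End mesh_exists.

(** * Scaling, symmetry, triangle inequality and the equality case *)

Section consequences.
Context (R : realType) (X : completeMetricType R).
Hypothesis sepX : separable X.
Variables (l : R) (l_gt0 : 0 < l).
Implicit Types (mu : finmeas X R).

Let k_ge0 (x y : X) : 0 <= tcos (l * mdist x y).
Proof. by rewrite tcos_ge0// mulr_ge0 ?mdist_ge0// ltW. Qed.

(** Multiplying the first matrix by [r] and the second by [s] turns an almost optimal pair for the
    given measures into an admissible one for the scaled measures, on a mesh common to all four. *)
Lemma aff_scale_le (mu0 mu1 mu0' mu1' : finmeas X R) (r s : R) : 0 <= r -> 0 <= s ->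
  (forall A, measurable A -> fine (mu0' A) = r ^+ 2 * fine (mu0 A)) ->
  (forall A, measurable A -> fine (mu1' A) = s ^+ 2 * fine (mu1 A)) ->
  r * s * aff l mu0 mu1 <= aff l mu0' mu1'.
Proof.
move=> r0 s0 E0 E1; apply/ler_addgt0Pr => e e0.
pose M (a : bool * bool) := match a with
  | (false, false) => mu0 | (false, true) => mu1
  | (true, false) => mu0' | (true, true) => mu1' end.
(* The mesh error enters twice, once multiplied by [r * s] and once alone. *)
have d0 : 0 < e / (r * s + 1) by rewrite divr_gt0// ltr_wpDl// mulr_ge0.
have [n [x [B [mB _ lo up]]]] := aff_mesh sepX l_gt0 M d0.
have [V [W [VW le]]] := lo (false, false) (false, true).
have := subcouplingZ VW r0 s0.
have -> : (fun i => r ^+ 2 * fine (M (false, false) (B i))) =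
    (fun i => fine (M (true, false) (B i))) by apply/funext => i; rewrite /= E0.
have -> : (fun i => s ^+ 2 * fine (M (false, true) (B i))) =
    (fun i => fine (M (true, true) (B i))) by apply/funext => i; rewrite /= E1.
move=> /(up (true, false) (true, true)) /=.
have -> : \sum_i \sum_j r * V i j * (s * W i j) * tcos (l * mdist (x i) (x j)) =
    r * s * \sum_i \sum_j V i j * W i j * tcos (l * mdist (x i) (x j)).
  rewrite mulr_sumr; apply: eq_bigr => i _; rewrite mulr_sumr; apply: eq_bigr => j _.
  ring.
move: le => /(ler_wpM2l (mulr_ge0 r0 s0)).
have : e / (r * s + 1) * (r * s) + e / (r * s + 1) = e.
  by field; rewrite gt_eqF// ltr_wpDl// mulr_ge0.
rewrite /=; lra.
Qed.

Lemma aff_sym_le mu0 mu1 : aff l mu0 mu1 <= aff l mu1 mu0.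
Proof.
apply/ler_addgt0Pr => e e0.
have [n [x [B [mB _ lo up]]]] :=
  aff_mesh sepX l_gt0 (fun a : bool => if a then mu1 else mu0) (divr_gt0 e0 (ltr0n R 2)).
have [V [W [VW le]]] := lo false true.
have := up true false _ _ (subcoupling_tr VW).
rewrite exchange_big/=; under eq_bigr do
  under eq_bigr do rewrite mulrC metric_sym [W _ _ * _]mulrC mulrC.
by move=> h; move: le => /=; lra.
Qed.

Lemma aff_sym mu0 mu1 : aff l mu0 mu1 = aff l mu1 mu0.
Proof. by apply/eqP; rewrite eq_le !aff_sym_le. Qed.

Lemma aff_le_sqrt mu0 mu1 : aff l mu0 mu1 <= Num.sqrt (mass mu0) * Num.sqrt (mass mu1).
Proof.
apply/ler_addgt0Pr => e e0.
have [n [x [B [mB m lo _]]]] :=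
  aff_mesh sepX l_gt0 (fun a : bool => if a then mu1 else mu0) e0.
have [V [W [VW le]]] := lo false true.
apply: le_trans le _; rewrite lerD2r -(m false) -(m true).
apply: le_trans (subcoupling_le VW); apply: ler_sum => i _; apply: ler_sum => j _.
by have [V0 W0 _ _] := VW; rewrite ler_piMr ?mulr_ge0// tcos_le1.
Qed.

(** The diagonal matrix of the square roots of the cell masses, used twice, represents leaving all
    mass in place. *)
Lemma aff_refl_ge mu0 mu1 : eq_meas mu0 mu1 -> mass mu0 <= aff l mu0 mu1.
Proof.
move=> E; apply/ler_addgt0Pr => e e0.
have [n [x [B [mB m _ up]]]] :=
  aff_mesh sepX l_gt0 (fun a : bool => if a then mu1 else mu0) e0.
pose V (i j : 'I_n) := if i == j then Num.sqrt (fine (mu0 (B i))) else 0.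
have := up false true V V.
have diag (f : 'I_n -> 'I_n -> R) i : (forall j, j != i -> f i j = 0) -> \sum_j f i j = f i i.
  by move=> f0; rewrite (bigD1 i)//= big1 ?addr0.
rewrite -(m false)/= => h; apply: le_trans (h _); last first.
  split.
  - by move=> i j; rewrite /V; case: ifP => // _; exact: sqrtr_ge0.
  - by move=> i j; rewrite /V; case: ifP => // _; exact: sqrtr_ge0.
  - move=> i; rewrite (diag (fun i j => V i j ^+ 2)) /V ?eqxx ?sqr_sqrtr ?fine_ge0//.
    by move=> j; rewrite eq_sym => /negbTE ->; rewrite expr0n.
  - move=> i; rewrite (diag (fun j i => V i j ^+ 2)) /V ?eqxx ?sqr_sqrtr ?fine_ge0 -?E//.
    by move=> j /negbTE ->; rewrite expr0n.
apply: ler_sum => i _.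
rewrite (diag (fun i j => V i j * V i j * tcos (l * mdist (x i) (x j)))).
  by rewrite mdistxx mulr0 tcos0 mulr1 /V eqxx -expr2 sqr_sqrtr ?fine_ge0.
by move=> j; rewrite /V eq_sym => /negbTE ->; rewrite !mul0r.
Qed.

Lemma aff_triangle mu0 mu1 mu2 : mass mu0 = 1 -> mass mu1 = 1 -> mass mu2 = 1 ->
  sphere_cosD (aff l mu0 mu1) (aff l mu1 mu2) <= aff l mu0 mu2.
Proof.
move=> m0 m1 m2; apply/ler_addgt0Pr => e e0.
have aff01 mu mu' : mass mu = 1 -> mass mu' = 1 -> 0 <= aff l mu mu' <= 1.
  move=> mu1' mu'1; rewrite aff_ge0//= (le_trans (aff_le_sqrt _ _))//.
  by rewrite mu1' mu'1 sqrtr1 mulr1.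
(* [sphere_cosD_le] costs [4 * s], and the mesh bound for the glued pair costs [s ^ 2 / 2 <= s]. *)
pose s := Num.min 1 (e / 5).
have s0 : 0 < s by rewrite lt_min ltr01 divr_gt0.
have s1 : s <= 1 by rewrite ge_min lexx.
have se : 5 * s <= e by rewrite mulrC -ler_pdivlMr// ge_min lexx orbT.
have ss0 : 0 < s ^+ 2 / 2 by rewrite divr_gt0// exprn_gt0.
pose M (a : option bool) :=
  match a with None => mu0 | Some false => mu1 | Some true => mu2 end.
have [n [x [B [mB m lo up]]]] := aff_mesh sepX l_gt0 M ss0.
have [V [W [VW le01]]] := lo None (Some false).
have [Z [T [ZT le12]]] := lo (Some false) (Some true).
have [V0 W0 Vp Wm] := VW; have [Z0 T0 Zm Tq] := ZT.
pose th i j : R := Num.min (l * mdist (x i) (x j)) (pi / 2).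
have [||||S [S' [S0 S'0 Sp S'q Sle]]] := glue V0 W0 Z0 T0 _ Vp Wm Zm Tq _ _ _ th th.
- by move=> i; exact: fine_ge0.
- by rewrite (m None)/= m0.
- by rewrite (m (Some false))/= m1.
- by rewrite (m (Some true))/= m2.
have {Sle}Sle := Sle _ _ _ (fun i j => k_ge0 (x i) (x j)) _ erefl erefl.
(* Angles truncated at [pi / 2] still satisfy the triangle inequality, and the sum of two of them
   stays in [[0, pi]], where the cosine decreases. *)
have cos_le i k j : cos (th i k + th k j) <= tcos (l * mdist (x i) (x j)).
  have l0 := ltW l_gt0.
  have d0 y z : 0 <= l * mdist (y : X) z by rewrite mulr_ge0 ?mdist_ge0.
  have /andP[h1 h2] := min_pihalf_itv (d0 (x i) (x k)).
  have /andP[h3 h4] := min_pihalf_itv (d0 (x k) (x j)).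
  have /andP[h5 h6] := min_pihalf_itv (d0 (x i) (x j)).
  rewrite /tcos ler_cos//; last by rewrite /th; lra.
  rewrite /th; have tri := ler_wpM2l l0 (metric_triangle (x i) (x k) (x j)).
  rewrite mulrDr in tri.
  have [h7|h7] := leP (l * mdist (x i) (x k)) (pi / 2); last first.
    by rewrite (le_trans h6)// lerDl.
  have [h8|h8] := leP (l * mdist (x k) (x j)) (pi / 2); last first.
    by rewrite (le_trans h6)// lerDr.
  by rewrite ge_min tri.
have {}Sle := Sle cos_le.
have {}up := up None (Some true) S S' (And4 S0 S'0 Sp S'q).
set a := \sum_i _ in Sle; set b := \sum_i _ in Sle.
have ab01 mu mu' (v w : 'I_n -> 'I_n -> R) p q : \sum_i p i = 1 -> \sum_i q i = 1 ->
    subcoupling v w p q ->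
    0 <= \sum_i \sum_j v i j * w i j * tcos (l * mdist (x i) (x j)) <= 1.
  move=> p1 q1 vw; have [v0 w0 _ _] := vw; apply/andP; split.
    by apply: sumr_ge0 => i _; apply: sumr_ge0 => j _; rewrite !mulr_ge0.
  have := subcoupling_le vw; rewrite p1 q1 sqrtr1 mulr1; apply: le_trans.
  apply: ler_sum => i _; apply: ler_sum => j _.
  by rewrite ler_piMr ?mulr_ge0// tcos_le1.
have p1 o : \sum_i fine (M o (B i)) = 1 by rewrite (m o); case: o => [[]|].
have := sphere_cosD_le (ltW s0) s1 (aff01 _ _ m0 m1) (aff01 _ _ m1 m2)
  (ab01 mu0 mu1 _ _ _ _ (p1 _) (p1 _) VW) (ab01 mu1 mu2 _ _ _ _ (p1 _) (p1 _) ZT) le01 le12.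
move=> h; rewrite (le_trans h)//.
have ss : s ^+ 2 <= s by rewrite expr2 ler_piMl// ltW.
move: Sle up; rewrite -/(sphere_cosD a b) /=; move: ss0; lra.
Qed.

(** With the cells [C], [D] and their complements, affinity 1 makes the two matrices almost equal
    and their row and column bounds almost sharp, and forbids mass from [C] to the complement of
    [D], where the kernel is at most [kap < 1]. So almost all of [nu0 C] is matched inside [D]. *)
Lemma mass_le_of_aff_eq1 (nu0 nu1 : finmeas X R) (C D : set (borel X)) (r : R) :
  mass nu0 = 1 -> mass nu1 = 1 -> aff l nu0 nu1 = 1 ->
  measurable C -> measurable D -> 0 < r ->
  (forall x y : X, C x -> ~ D y -> r <= mdist x y) ->
  fine (nu0 C) <= fine (nu1 D).
Proof.
move=> m0 m1 A1 mC mD r0 CD; apply/ler_addgt0Pr => e e0.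
pose kap := tcos (l * r).
have kap1 : 0 < 1 - kap by rewrite subr_gt0 tcos_lt1// mulr_gt0.
(* The errors add up to at most [8 * s + s / (1 - kap)]: [2 * s] for the unsharp row bound, [4 * s]
   and [2 * s] from [v11] and [v22], and the last term from [vw2]. *)
pose K := 9 + (1 - kap)^-1.
have K0 : 0 < K by rewrite addr_gt0 ?invr_gt0.
pose s := Num.min 1 (e / K).
have s0 : 0 < s by rewrite lt_min ltr01 divr_gt0.
have s1 : s <= 1 by rewrite ge_min lexx.
have sK : s * K <= e by rewrite -ler_pdivlMr// ge_min lexx orbT.
have ss0 : 0 < s ^+ 2 by rewrite exprn_gt0.
pose B (E : set (borel X)) (b : bool) := if b then E else ~` E.
have mB E : measurable E -> forall b, measurable (B E b).
  by move=> mE [] //; exact: measurableC.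
have tB E : trivIset setT (B E).
  by apply/trivIsetP => -[] [] //= _ _ _; rewrite ?setICr ?setICl.
have BT E : \bigcup_b B E b = setT.
  apply/seteqP; split => // x _; have [Ex|Ex] := pselect (E x).
    by exists true.
  by exists false.
pose c (b b' : bool) : R := if b && ~~ b' then kap else 1.
have [|V [W [VW le]]] := @aff_lower _ _ sepX _ l_gt0 _ _ (B C) (B D) c nu0 nu1 _ ss0
    (mB C mC) (tB C) (BT C) (mB D mD) (tB D) (BT D).
  move=> [] [] x y //= Cx Dy; rewrite /c/= ?tcos_le1//.
  by rewrite le_tcos ?ler_wpM2l ?mulr_ge0 ?(ltW l_gt0) ?(ltW r0)//; exact: CD.
have [V0 W0 Vp Wq] := VW.
have pf : fine (nu0 C) + fine (nu0 (~` C)) = 1.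
  rewrite -m0 /mass -fineD ?fin_num_measure//; last exact: measurableC.
  by rewrite -measureU ?setUv ?setICr//; exact: measurableC.
have qf : fine (nu1 D) + fine (nu1 (~` D)) = 1.
  rewrite -m1 /mass -fineD ?fin_num_measure//; last exact: measurableC.
  by rewrite -measureU ?setUv ?setICr//; exact: measurableC.
move: le (Vp true) (Vp false) (Wq true) (Wq false).
rewrite A1 !big_bool /c/= ?mulr1.
move: (V0 true true) (V0 true false) (V0 false true) (V0 false false).
move: (W0 true true) (W0 true false) (W0 false true) (W0 false false).
move: (V true true) (V true false) (V false true) (V false false).
move: (W true true) (W true false) (W false true) (W false false).
move=> w1 w2 w3 w4 v1 v2 v3 v4 w10 w20 w30 w40 v10 v20 v30 v40.
set p := fine (nu0 C) in pf *; set q := fine (nu1 D) in qf *.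
move=> le vp vp' wq wq'.
have ss : s ^+ 2 <= s by rewrite expr2 ler_piMl// ltW.
have kap0 : v2 * w2 * kap <= v2 * w2 by rewrite ler_piMr ?mulr_ge0// -subr_ge0 ltW.
(* The squares of each matrix sum to at most 1, while the sum of the products is at least
   [1 - s ^ 2]; hence the squared differences sum to at most [2 * s ^ 2]. *)
have sq (t t' : R) : 2 * (t * t') = t ^+ 2 + t' ^+ 2 - (t - t') ^+ 2 by ring.
have := (sq v1 w1, sq v2 w2, sq v3 w3, sq v4 w4) => -[[[s_1 s_2] s_3] s_4].
have := (sqr_ge0 (v1 - w1), sqr_ge0 (v2 - w2), sqr_ge0 (v3 - w3), sqr_ge0 (v4 - w4)).
move=> -[[[g1 g2] g3] g4].
have close (t t' : R) : (t - t') ^+ 2 <= 2 * s ^+ 2 -> t - t' <= 2 * s.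
  move=> h; rewrite (le_trans (ler_norm _))// -(@ler_pXn2r _ 2) ?nnegrE ?mulr_ge0 ?(ltW s0)//.
  by rewrite real_normK ?num_real// exprMn (le_trans h)// ler_wpM2r ?sqr_ge0//; lra.
have d1 : v1 - w1 <= 2 * s by apply: close; lra.
have d2 : v2 - w2 <= 2 * s by apply: close; lra.
have q0 : 0 <= q by exact: fine_ge0.
have p0 : 0 <= p by exact: fine_ge0.
have pc0 : 0 <= fine (nu0 (~` C)) by exact: fine_ge0.
have qc0 : 0 <= fine (nu1 (~` D)) by exact: fine_ge0.
have le1 (t t' z : R) : t ^+ 2 + t' ^+ 2 <= z -> z <= 1 -> 0 <= t -> t <= 1.
  move=> h1 h2 t0; rewrite -(@ler_pXn2r _ 2) ?nnegrE// expr1n.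
  by have := sqr_ge0 t'; lra.
have v1le : v1 <= 1 by apply: (le1 _ _ _ vp) => //; lra.
have v2le : v2 <= 1 by apply: (le1 v2 v1 p) => //; lra.
have w1le : w1 <= 1 by apply: (le1 _ _ _ wq) => //; lra.
have v22 : v2 ^+ 2 <= v2 * w2 + 2 * s.
  have : v2 * (v2 - w2) <= 1 * (2 * s).
    rewrite (le_trans (ler_wpM2l v20 d2))// ler_wpM2r// mulr_ge0// ltW//.
  by rewrite mulrBr expr2; lra.
have v11 : v1 ^+ 2 <= w1 ^+ 2 + 4 * s.
  have : (v1 + w1) * (v1 - w1) <= 2 * (2 * s).
    rewrite (le_trans (ler_wpM2l _ d1)) ?addr_ge0// ler_wpM2r ?mulr_ge0 ?(ltW s0)//.
    by lra.
  by rewrite mulrC -subr_sqr; lra.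
have vw2 : v2 * w2 <= s * (1 - kap)^-1.
  rewrite ler_pdivlMr// mulrBr mulr1; lra.
have := sqr_ge0 w3; rewrite mulrDr in sK; lra.
Qed.

End consequences.

(** * Affinity 1 characterizes equality *)

Section identity.
Context (R : realType) (X : completeMetricType R).
Hypothesis sepX : separable X.
Variables (l : R) (l_gt0 : 0 < l).

(** The open neighbourhoods [D n] of [C] with radius [n.+1%:R^-1] decrease to [C] because [C] is
    closed; the bounds on [nu1 (D n)] pass to the limit by continuity from above. *)
Lemma le_closed_of_aff_eq1 (nu0 nu1 : finmeas X R) (C : set X) :
  mass nu0 = 1 -> mass nu1 = 1 -> aff l nu0 nu1 = 1 -> closed C ->
  (nu0 C <= nu1 C)%E.
Proof.
move=> m0 m1 A1 clC.
have mC : measurable (C : set (borel X)).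
  rewrite -[C]setCK; apply: measurableC; apply: sub_sigma_algebra.
  exact: closed_openC.
pose D n : set (borel X) := \bigcup_(x in C) [set y : X | mdist x y < n.+1%:R^-1].
have mD n : measurable (D n).
  apply: sub_sigma_algebra; apply: bigcup_open => x _.
  rewrite -ballEmdist openE => y; rewrite ballEmdist/= => xy; apply/nbhs_ballP.
  exists (n.+1%:R^-1 - mdist x y); first by rewrite /= subr_gt0.
  move=> z; rewrite !ballEmdist/= => yz.
  by rewrite (le_lt_trans (metric_triangle _ y _))// -ltrBrDl.
have DC : \bigcap_n D n = C.
  apply/seteqP; split => [y Dy|y Cy n _]; last first.
    by exists y => //=; rewrite mdistxx invr_gt0.
  apply: clC => U /nbhs_ballP[e /= e0 eU].
  have [n ne] : exists n, n.+1%:R^-1 < e :> R.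
    exists (Num.truncn e^-1); rewrite invf_plt ?posrE//; exact: truncnS_gt.
  have [x Cx /= xy] := Dy n I; exists x; split => //; apply: eU.
  by rewrite ballEmdist/= metric_sym (lt_trans xy).
have Dle n : (nu0 C <= nu1 (D n))%E.
  rewrite -[leLHS]fineK ?fin_num_measure// -[leRHS]fineK ?fin_num_measure// lee_fin.
  apply: (mass_le_of_aff_eq1 sepX l_gt0 m0 m1 A1 mC (mD n) (r := n.+1%:R^-1)).
    by rewrite invr_gt0.
  by move=> x y Cx Dy; rewrite leNgt; apply/negP => xy; apply: Dy; exists x.
have cvg : (nu1 \o D) n @[n --> \oo] --> nu1 (\bigcap_n D n).
  apply: nonincreasing_cvg_mu => //.
  - by rewrite ltey_eq fin_num_measure.
  - by rewrite DC.
  - move=> n m nm; apply/subsetPset => y [x Cx /= xy]; exists x => //=.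
    by rewrite (lt_le_trans xy)// lef_pV2 ?posrE// ler_nat.
rewrite DC in cvg.
rewrite -(cvg_lim _ cvg)//; apply: lime_ge; first by apply/cvg_ex; eexists; exact: cvg.
by near=> n; exact: Dle.
Unshelve. all: by end_near.
Qed.

(** Symmetry of [aff] gives equality on closed sets; complements give it on open sets, an
    intersection-stable family that generates the Borel sets. *)
Lemma eq_meas_of_aff_eq1 (nu0 nu1 : finmeas X R) :
  mass nu0 = 1 -> mass nu1 = 1 -> aff l nu0 nu1 = 1 -> eq_meas nu0 nu1.
Proof.
move=> m0 m1 A1; have A1' : aff l nu1 nu0 = 1 by rewrite aff_sym.
have clE C : closed C -> nu0 C = nu1 C.
  by move=> clC; apply/eqP; rewrite eq_le !le_closed_of_aff_eq1.
have mE (nu : finmeas X R) (O : set X) : open O -> nu O = (nu setT - nu (~` O))%E.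
  move=> oO; have mO : measurable (O : set (borel X)) by exact: sub_sigma_algebra.
  rewrite -(setUv O) measureU ?setICr//; last exact: measurableC.
  by rewrite addeK// fin_num_measure//; exact: measurableC.
move=> A mA.
apply: (@measure_unique _ R (borel X) (@open X) (fun _ => setT) _ _ _ _ nu0 nu1) => //.
- by move=> O O'; exact: openI.
- by move=> _; exact: openT.
- by apply/seteqP; split => // x _; exists 0%N.
- move=> O oO; apply: (etrans (mE nu0 O oO)); apply: (etrans _ (esym (mE nu1 O oO))).
  by rewrite (clE setT)// (clE (~` O))//; exact: open_closedC.
- by move=> _; rewrite ltey_eq fin_num_measure.
Qed.

End identity.

(** * Cone structure *)

Section cone.
Context (R : realType) (X : completeMetricType R).
Hypothesis sepX : separable X.
Variables (l : R) (l_gt0 : 0 < l).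
Implicit Types nu : probability (borel X) R.

Lemma mass_prob nu : mass nu = 1.
Proof. by rewrite /mass -[RHS]/(fine 1%E); congr fine; exact: probability_setT. Qed.

Lemma aff_itv nu0 nu1 : 0 <= aff l nu0 nu1 <= 1.
Proof.
rewrite aff_ge0//= (le_trans (aff_le_sqrt sepX l_gt0 _ _))//.
by rewrite !mass_prob sqrtr1 mulr1.
Qed.

Lemma SHKE nu0 nu1 : SHK l nu0 nu1 = acos (aff l nu0 nu1).
Proof. by rewrite /SHK /aff !mass_prob; congr acos; field. Qed.

Let itv1 (a : R) : 0 <= a <= 1 -> -1 <= a <= 1.
Proof. by move=> /andP[a0 ->]; rewrite (le_trans _ a0)// lerN10. Qed.

Lemma cos_SHK nu0 nu1 : cos (SHK l nu0 nu1) = aff l nu0 nu1.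
Proof. by rewrite SHKE acosK// in_itv/=; exact/itv1/aff_itv. Qed.

Lemma mass_cone (z : probability (borel X) R * {nonneg R}) :
  mass (cone_map z) = z.2%:num ^+ 2.
Proof.
rewrite /mass/= /mscale/= -[RHS]mulr1 -[in RHS](mass_prob z.1) fineM//.
exact: fin_num_measure.
Qed.

Lemma fine_cone (z : probability (borel X) R * {nonneg R}) A : measurable A ->
  fine (cone_map z A) = z.2%:num ^+ 2 * fine (z.1 A).
Proof. by move=> mA; rewrite /cone_map/= /mscale/= fineM ?fin_num_measure. Qed.

(** One inequality is [aff_scale_le]; the other is the same lemma with the inverse radii, or, if a
    radius is 0, the bound of [aff] by the masses. *)
Lemma aff_cone (z0 z1 : probability (borel X) R * {nonneg R}) :
  aff l (cone_map z0) (cone_map z1) = z0.2%:num * z1.2%:num * aff l z0.1 z1.1.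
Proof.
apply/eqP; rewrite eq_le; apply/andP; split; last first.
  by apply: aff_scale_le => // A mA; exact: fine_cone.
set r0 := z0.2%:num; set r1 := z1.2%:num.
have [rr0|rr0] := eqVneq (r0 * r1) 0.
  rewrite rr0 mul0r (le_trans (aff_le_sqrt sepX l_gt0 _ _))//.
  by rewrite !mass_cone !sqrtr_sqr !ger0_norm// rr0.
have /andP[r0n r1n] : (r0 != 0) && (r1 != 0) by rewrite -negb_or -mulf_eq0.
have := @aff_scale_le R X sepX l l_gt0 (cone_map z0) (cone_map z1) z0.1 z1.1
  r0^-1 r1^-1.
have r0p : 0 <= r0 by rewrite /r0.
have r1p : 0 <= r1 by rewrite /r1.
rewrite !invr_ge0 => /(_ r0p r1p) h.
have {}h : r0^-1 * r1^-1 * aff l (cone_map z0) (cone_map z1) <= aff l z0.1 z1.1.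
  by apply: h => A mA; rewrite fine_cone// mulrA -exprMn mulVf// expr1n mul1r.
have rr : 0 < r0 * r1 by rewrite lt_def rr0 mulr_ge0.
by rewrite mulrC -ler_pdivrMr// mulrC invfM.
Qed.

End cone.

Theorem theorem3p4 (R : realType) (X : completeMetricType R)
  (sepX : separable X) (geoX : geodesic_space X) (l : R) (l_gt0 : 0 < l) :
  [/\ metric_upto (fun nu0 nu1 : probability (borel X) R => eq_meas nu0 nu1)
        (SHK l),
      forall mu : finmeas X R,
        exists z : probability (borel X) R * {nonneg R},
          eq_meas (cone_map z) mu,
      forall z0 z1 : probability (borel X) R * {nonneg R},
        eq_meas (cone_map z0) (cone_map z1) <->
        cone_eq (fun nu0 nu1 : probability (borel X) R => eq_meas nu0 nu1) z0 z1,
      forall z0 z1 : probability (borel X) R * {nonneg R},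
        HK2 l (cone_map z0) (cone_map z1) = (cone_dist2 (SHK l) z0 z1)%:E &
      (diameter (@SHK R X l) <= (pi / 2)%:E)%E].
Proof.
have itv nu0 nu1 := aff_itv sepX l_gt0 nu0 nu1.
have itv1 (nu0 nu1 : probability (borel X) R) : -1 <= aff l nu0 nu1 <= 1.
  by have /andP[h ->] := itv nu0 nu1; rewrite (le_trans _ h)// lerN10.
have shkE := SHKE l.
split.
- split.
  + by move=> nu0 nu1; rewrite shkE acos_ge0.
  + move=> nu0 nu1; split => [h|h].
      apply: (eq_meas_of_aff_eq1 sepX l_gt0); rewrite ?mass_prob//.
      by rewrite -(cos_SHK sepX l_gt0) h cos0.
    have := aff_refl_ge sepX l_gt0 h; rewrite mass_prob => A1.
    have /andP[_ A1'] := itv nu0 nu1.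
    rewrite shkE (_ : aff l nu0 nu1 = 1) ?acos1//.
    by apply/eqP; rewrite eq_le A1'.
  + by move=> nu0 nu1; rewrite !shkE aff_sym.
  + move=> nu0 nu1 nu2; rewrite !shkE acos_triangle//.
      by have /andP[] := itv nu0 nu2.
    by apply: aff_triangle; rewrite ?mass_prob.
- move=> mu; pose P : probability (borel X) R := dirac (point : borel X).
  have [m0|m0] := eqVneq (mass mu) 0.
    (* A null measure is the vertex of the cone, represented with an arbitrary probability, here a
       Dirac mass. *)
    exists (P, 0%:nng) => A mA /=.
    rewrite /mscale/= expr0n mul0e; apply/esym/eqP; rewrite -measure_le0.
    have <- : mu setT = 0%E by rewrite -[LHS]fineK ?fin_num_measure// -/(mass mu) m0.
    by apply: le_measure; rewrite ?inE.
  exists (mnormalize mu P : probability (borel X) R, (Num.sqrt (mass mu))%:nng) => A mA.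
  have muT : mu setT = (mass mu)%:E by rewrite fineK// fin_num_measure.
  have muA : mu A = (fine (mu A))%:E by rewrite fineK// fin_num_measure.
  have mnE : mnormalize mu P A = (fine (mu A) / mass mu)%:E.
    rewrite /mnormalize; case: ifPn => [/orP[/eqP|/eqP] /(etrans (esym muT))|_].
    - by move=> [m0']; rewrite m0' eqxx in m0.
    - by [].
    - by rewrite EFinM; congr (_ * _)%E; exact: muA.
  rewrite /cone_map/= /mscale/= sqr_sqrtr ?mass_ge0//.
  by rewrite [X in (_ * X)%E]mnE muA -EFinM mulrC divfK.
- move=> z0 z1; split => [h|[[z00 z10]|[h zz]] A mA]; last 2 first.
  + by rewrite /cone_map/= /mscale/= z00 z10 expr0n !mul0e.
  + by rewrite /cone_map/= /mscale/= zz h.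
  (* The total mass of [cone_map z] is the square of its radius, so equal measures have equal
     radii. *)
  have zz : z0.2%:num = z1.2%:num.
    apply/eqP; rewrite -(@eqrXn2 _ 2)//; apply/eqP.
    by rewrite -!mass_cone /mass; congr fine; exact: h.
  have [z00|z00] := eqVneq z0.2%:num 0; first by left; rewrite -zz.
  right; split => // A mA.
  have := congr1 fine (h A mA); rewrite !fine_cone// -zz.
  move=> /(mulfI _) E; rewrite -[LHS]fineK ?fin_num_measure// E ?fineK ?fin_num_measure//.
  by rewrite expf_neq0.
- move=> z0 z1; rewrite HK2E// !mass_cone aff_cone// /cone_dist2 min_r.
    by rewrite cos_SHK// !mulrA.
  by rewrite shkE acos_lepi.
- apply: ge_ereal_sup => _ [[nu0 nu1] _ <-].
  by rewrite lee_fin shkE acos_le_pihalf.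
Qed.
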